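(* Let $\mu$ be a freely infinitely divisible (FID) probability measure on $\mathbb{R}$ with free characteristic triplet $(\eta_\mu,a_\mu,\nu_\mu)$. The following are equivalent: (1) $\mu^{\boxplus s}$ is not continuous for some $s>0$; (2) $\mu$ is of free type A, i.e. $a_\mu=0$ and $\nu_\mu(\mathbb{R})<\infty$. In this case, $\mu^{\boxplus s}$ has an atom at $s\,F_\mu^{-1}(+i0)$ with mass $1-s\,\nu_\mu(\mathbb{R})$ for $0\le s<\nu_\mu(\mathbb{R})^{-1}$, and $\mu^{\boxplus s}$ does not have an atom for $s\ge\nu_\mu(\mathbb{R})^{-1}$. Here $\nu_\mu(\mathbb{R})^{-1}$ is understood to be $\infty$ if $\nu_\mu(\mathbb{R})=0$.
   Context: A measure $\rho$ on $\mathbb{R}$ is continuous if $\rho(\{x\})=0$ for every $x\in\mathbb{R}$. Free convolution: for a probability measure $\mu$ on $\mathbb{R}$ let $G_\mu(z)=\int_{\mathbb{R}}\frac{1}{z-x}\,\mu(dx)$ and $F_\mu(z)=1/G_\mu(z)$ for $z\in\mathbb{C}^+$. The right compositional inverse $F_\mu^{-1}$ exists on a truncated cone $\{z\in\mathbb{C}^+ : \operatorname{Im}(z)>M,\ |\operatorname{Re}(z)|<\lambda\operatorname{Im}(z)\}$. The free cumulant transform is $\mathcal{C}_\mu(z)=zF_\mu^{-1}(1/z)-1$ (for $1/z$ in the cone). The free convolution $\boxplus$ is characterized by $\mathcal{C}_{\mu\boxplus\rho}=\mathcal{C}_\mu+\mathcal{C}_\rho$ on the common domain. FID measures: $\mu$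 is freely infinitely divisible (FID) if for every $n\in\mathbb{N}$ there is a probability measure $\mu_n$ with $\mu_n^{\boxplus n}=\mu$. Equivalently, $\mathcal{C}_\mu$ extends to $\mathbb{C}^-$ with the free L\'evy--Khintchine representation $$\mathcal{C}_\mu(z)=\eta_\mu z+a_\mu z^2+\int_{\mathbb{R}}\Big(\frac{1}{1-tz}-1-tz1_{[-1,1]}(t)\Big)\nu_\mu(dt),\qquad z\in\mathbb{C}^-,$$ where $\eta_\mu\in\mathbb{R}$, $a_\mu\ge0$ and $\nu_\mu$ is a nonnegative measure on $\mathbb{R}$ with $\nu_\mu(\{0\})=0$ and $\int_{\mathbb{R}}\min\{1,t^2\}\,\nu_\mu(dt)<\infty$. The triplet $(\eta_\mu,a_\mu,\nu_\mu)$ is unique and called the free characteristic triplet; $\nu_\mu$ is the free L\'evy measure. For $s\ge0$, $\mu^{\boxplus s}$ denotes the FID measure with free characteristic triplet $(s\eta_\mu,sa_\mu,s\nu_\mu)$. For FID $\mu$, $F_\mu^{-1}$ denotes the analytic extension to $\mathbb{C}^+$ given by $F_\mu^{-1}(z)=z+z\,\mathcal{C}_\mu(1/z)$, and $F_\mu^{-1}(+i0):=\lim_{y\downarrow0}F_\mu^{-1}(iy)$. *)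

(* Defs.v *)
From HB Require Import structures.
From mathcomp Require Import all_boot all_order all_algebra.
From mathcomp Require Import all_classical all_reals all_analysis.
From mathcomp Require Import complex.

Set Implicit Arguments.
Unset Strict Implicit.
Unset Printing Implicit Defensive.

Import Order.TTheory GRing.Theory Num.Theory.
Import numFieldNormedType.Exports.

Local Open Scope classical_set_scope.
Local Open Scope complex_scope.
Local Open Scope ring_scope.

Section free_probability.
Context {R : realType}.

Local Notation C := R[i].

(* [measurableTypeR R] is [R] with its Borel sigma-algebra. *)
Local Notation prob := (probability (measurableTypeR R) R).
Local Notation meas := {measure set (measurableTypeR R) -> \bar R}.

Implicit Types (mu rho sigma : prob) (nu : meas).

Definition continuous_measure (rho : meas) : Prop :=
  forall x : R, rho [set x] = 0%E.

Definition cintegral (rho : meas) (f : R -> C) : C :=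
  Rintegral rho setT (fun x => complex.Re (f x)) +i*
  Rintegral rho setT (fun x => complex.Im (f x)).

Definition cauchy_transform mu (z : C) : C :=
  cintegral mu (fun x => (z - x%:C)^-1).

Definition reciprocal_cauchy_transform mu (z : C) : C :=
  (cauchy_transform mu z)^-1.

Definition truncated_cone (lambda M : R) : set C :=
  [set z : C | M < complex.Im z /\ `|complex.Re z| < lambda * complex.Im z].

(* [g] is the right compositional inverse of F_mu on the cone with parameters
   [lambda] and [M].  F_mu need not be injective on the upper half-plane: for
   mu the uniform law on {-1, 1}, F_mu(w) = w - 1/w takes every value twice,
   at w and at -1/w.  The intended branch is, as usual, the one with values in
   a truncated cone on which F_mu is injective. *)
Definition right_inverse_on mu (lambda M : R) (g : C -> C) : Prop :=
  exists alpha beta : R,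
    [/\ 0 < alpha, 0 < beta,
        {in truncated_cone alpha beta &,
          injective (reciprocal_cauchy_transform mu)} &
        forall z, truncated_cone lambda M z ->
          truncated_cone alpha beta (g z) /\
          reciprocal_cauchy_transform mu (g z) = z].

Definition free_cumulant_on mu (lambda M : R) (K : C -> C) : Prop :=
  exists2 g : C -> C, right_inverse_on mu lambda M g &
    forall z, truncated_cone lambda M z^-1 -> K z = z * g z^-1 - 1.

(* sigma is the free convolution of mu and rho.  Cumulant transforms are
   analytic, so it does not matter which common cone is used. *)
Definition free_convolution mu rho sigma : Prop :=
  exists lambda M : R, exists K1 K2 : C -> C,
    [/\ 0 < lambda, 0 < M,
        free_cumulant_on mu lambda M K1,
        free_cumulant_on rho lambda M K2 &
        free_cumulant_on sigma lambda M (fun z => K1 z + K2 z)].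

(* sigma is the [n]-fold free convolution of mu with itself. *)
Fixpoint free_convolution_power mu (n : nat) sigma : Prop :=
  if n is m.+1 then
    exists2 tau : prob, free_convolution_power mu m tau &
      free_convolution tau mu sigma
  else forall A : set (measurableTypeR R), measurable A ->
         sigma A = dirac (0 : measurableTypeR R) A.

Definition freely_infinitely_divisible mu : Prop :=
  forall n : nat, (0 < n)%N ->
    exists mun : prob, free_convolution_power mun n mu.

Definition levy_measure nu : Prop :=
  nu [set 0] = 0%E /\
  (\int[nu]_t (Num.min 1 (t ^+ 2))%:E < +oo)%E.

Definition free_levy_khintchine (eta a : R) nu (z : C) : C :=
  eta%:C * z + a%:C * z ^+ 2 +
  cintegral nu (fun t =>
    (1 - t%:C * z)^-1 - 1 - t%:C * z * (\1_(`[-1, 1]) t)%:C).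

(* The right-hand side of the representation is analytic on the lower
   half-plane, so agreement with the cumulant transform of mu wherever the
   latter is defined is agreement with its analytic extension. *)
Definition free_characteristic_triplet mu (eta a : R) nu : Prop :=
  [/\ 0 <= a, levy_measure nu &
      exists lambda M : R,
        [/\ 0 < lambda, 0 < M &
            free_cumulant_on mu lambda M (free_levy_khintchine eta a nu)]].

Definition FID_with_triplet mu (eta a : R) nu : Prop :=
  freely_infinitely_divisible mu /\ free_characteristic_triplet mu eta a nu.

Definition free_type_A (a : R) nu : Prop :=
  a = 0 /\ (nu setT < +oo)%E.

(* The analytic extension of the right inverse of F_mu to the upper half-plane,
   for mu with free characteristic triplet [(eta, a, nu)]. *)
Definition extended_right_inverse (eta a : R) nu (z : C) : C :=
  z + z * free_levy_khintchine eta a nu z^-1.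

End free_probability.

(* Main.v *)
Require Import Defs.
From mathcomp Require Import all_boot all_order all_algebra.
From mathcomp Require Import all_classical all_reals all_analysis.
From mathcomp Require Import complex.
From mathcomp Require Import measurable_realfun ring lra.

(** Let [rho] be a law with free characteristic triplet [(eta, a, nu)], let [G]
    be its Cauchy transform, [F = 1 / G], and let [H] be the extended right
    inverse. Up to a compensation of the integral by terms that are real and do
    not depend on [w], [H w] is [w + eta + a / w + \int (t^2 / (w - t)) nu(dt)],
    so that [Im (H w) = Im w * (1 - A w)] where the energy [A w] is [a / |w|^2 +
    \int (t^2 / |w - t|^2) nu(dt)] ([Im_right_inverse]), and the divided
    differences of [H] are governed by the same energy ([right_inverse_dist]).

    The triplet only says that [F (H w) = w] far away in a cone. By analytic
    continuation [H (F z) = z] in the whole upper half-plane ([reciprocalK]),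
    and [F (H w) = w] as soon as [H w] is in the upper half-plane, because a
    point of the upper half-plane has at most one preimage by [H]
    ([right_inverse_inj], [right_inverseK]). The continuation rests on a maximum
    principle for functions with a second-order complex expansion at each point
    ([maximum_principle]): the mean of [|f|^2] over the four points [p + d], [p
    + id], [p - d], [p - id] is at least [|f p|^2] up to [O(d^3)]. It yields an
    identity theorem, applied to [H (F z) - z], and an open mapping lemma, which
    shows that the image of the cone by [H] has an interior point.

    The mass of [rho] at [x] is the nontangential limit of [(z - x) * G z = (z -
    x) / F z] ([atom_limit]). If it is [m > 0], let [z] tend to [x] vertically
    and [w = F z], so [H w = z] and [w] tends to 0 nontangentially. The energy
    at [w] is less than 1 since [Im z > 0]; letting [w] tend to 0 gives [a = 0],
    and [nu(R) <= 1] by Fatou's lemma ([nontangential_type_A]). For [a = 0] and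
    [nu] finite, [H] has a nontangential derivative at 0: [H w = x0 + w * (1 -
    nu(R) + o(1))] with [x0 = H(+i0)] ([type_A_expansion]); comparing, [x = x0]
    and [m = 1 - nu(R)] ([atom_type_A]). In particular there is no atom if
    [nu(R) >= 1]. Conversely, if [nu(R) < 1] then [H] maps the imaginary axis
    into the upper half-plane and the same limit along [z = H(iy)] produces an
    atom of mass [1 - nu(R)] at [x0] ([type_A_atom]).

    The theorem is the case of the triplet [(s eta, s a, s nu)], for which
    [H(+i0)] and [nu(R)] are multiplied by [s] ([free_drift_mscale]). *)

Set Implicit Arguments.
Unset Strict Implicit.
Unset Printing Implicit Defensive.

Import Order.TTheory GRing.Theory Num.Theory.
Import numFieldNormedType.Exports.

Local Open Scope classical_set_scope.
Local Open Scope complex_scope.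
Local Open Scope ring_scope.

Import ComplexField.Normc.

(** * The modulus of a complex number *)

Section modulus.
Context {R : rcfType}.
Implicit Types z w : R[i].

Lemma normc_ge0 z : 0 <= normc z.
Proof. by case: z => a b; apply: sqrtr_ge0. Qed.

Lemma normc_sqr z : normc z ^+ 2 = complex.Re z ^+ 2 + complex.Im z ^+ 2.
Proof. by case: z => a b; rewrite sqr_sqrtr// addr_ge0 ?sqr_ge0. Qed.

Lemma normc_gt0 z : (0 < normc z) = (z != 0).
Proof.
rewrite lt_neqAle normc_ge0 andbT eq_sym; congr (~~ _).
by apply/eqP/eqP => [/eq0_normc//|->]; rewrite normc0.
Qed.

Lemma normcD_le z w : normc (z + w) <= normc z + normc w.
Proof. exact: le_normcD. Qed.

Lemma normc_opp z : normc (- z) = normc z.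
Proof. exact: normcN. Qed.

Lemma normcB_le z w : normc (z - w) <= normc z + normc w.
Proof. by rewrite -(normc_opp w) normcD_le. Qed.

Lemma normc_triangle_rev z w : normc z - normc w <= normc (z + w).
Proof.
have := normcB_le (z + w) w; rewrite addrK; lra.
Qed.

Lemma normcX z n : normc (z ^+ n) = normc z ^+ n.
Proof. by elim: n => [|n IH]; rewrite ?expr0 ?normc1// !exprS normcM IH. Qed.

Lemma normc_real (x : R) : normc x%:C = `|x|.
Proof. by rewrite /normc /= expr0n /= addr0 sqrtr_sqr. Qed.

Lemma normc_Re z : `|complex.Re z| <= normc z.
Proof.
case: z => a b /=; rewrite -(sqrtr_sqr a) ler_wsqrtr//.
by rewrite lerDl sqr_ge0.
Qed.

Lemma normc_Im z : `|complex.Im z| <= normc z.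
Proof.
case: z => a b /=; rewrite -(sqrtr_sqr b) ler_wsqrtr//.
by rewrite lerDr sqr_ge0.
Qed.

Lemma normc_le_ReIm z : normc z <= `|complex.Re z| + `|complex.Im z|.
Proof.
rewrite -(@ler_pXn2r _ 2) ?nnegrE ?addr_ge0 ?normc_ge0// normc_sqr sqrrD.
by rewrite !real_normK ?num_real// lerD2r lerDl mulrn_wge0// mulr_ge0.
Qed.

Lemma complexP z w :
  complex.Re z = complex.Re w -> complex.Im z = complex.Im w -> z = w.
Proof. by case: z w => a b [c d] /= -> ->. Qed.

End modulus.

(** * Second-order expansions *)

Section near_zero.
Context {R : rcfType}.
Local Notation C := R[i].

Definition near0 (P : C -> Prop) :=
  exists2 d : R, 0 < d & forall h, normc h < d -> P h.

Lemma near0_and P Q : near0 P -> near0 Q -> near0 (fun h => P h /\ Q h).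
Proof.
move=> [d d0 Pd] [e e0 Qe]; exists (Num.min d e); first by rewrite lt_min d0.
by move=> h; rewrite lt_min => /andP[hd he]; split; [exact: Pd|exact: Qe].
Qed.

Lemma near0_imp (P Q : C -> Prop) :
  (forall h, P h -> Q h) -> near0 P -> near0 Q.
Proof. by move=> PQ [d d0 Pd]; exists d => // h /Pd/PQ. Qed.

Lemma near0_lt d : 0 < d -> near0 (fun h => normc h < d).
Proof. by move=> d0; exists d. Qed.

Definition bounded_near0 (r : C -> C) :=
  exists M, near0 (fun h => normc (r h) <= M).

Lemma bounded_near0_cst c : bounded_near0 (fun=> c).
Proof. by exists (normc c); exists 1. Qed.

Lemma bounded_near0_id : bounded_near0 id.
Proof. by exists 1; exists 1 => // h /ltW. Qed.

Lemma bounded_near0D r s : bounded_near0 r -> bounded_near0 s ->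
  bounded_near0 (fun h => r h + s h).
Proof.
move=> [M rM] [N sN]; exists (M + N).
apply: near0_imp (near0_and rM sN) => h [? ?].
by rewrite (le_trans (normcD_le _ _))// lerD.
Qed.

Lemma bounded_near0M r s : bounded_near0 r -> bounded_near0 s ->
  bounded_near0 (fun h => r h * s h).
Proof.
move=> [M rM] [N sN]; exists (M * N).
apply: near0_imp (near0_and rM sN) => h [? ?].
by rewrite normcM ler_pM// normc_ge0.
Qed.

(** A second-order complex expansion with a cubic remainder. Asked at every
    point of an open set it characterises holomorphy, yet it is a condition at a
    single point, preserved by sums, products and compositions. *)
Definition jet2 (f : C -> C) (p : C) :=
  exists b c : C, exists2 r : C -> C, bounded_near0 r &
    near0 (fun h => f (p + h) = f p + b * h + c * h ^+ 2 + r h * h ^+ 3).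

Lemma jet2_near f g p : near0 (fun h => f (p + h) = g (p + h)) ->
  jet2 f p -> jet2 g p.
Proof.
move=> fg [b [c [r br fE]]]; exists b, c, r => //.
have fgp : f p = g p.
  by case: fg => d d0 /(_ 0); rewrite addr0; apply; rewrite normc0.
by apply: near0_imp (near0_and fg fE) => h [<- ->]; rewrite fgp.
Qed.

Lemma jet2_cst a p : jet2 (fun=> a) p.
Proof.
exists 0, 0, (fun=> 0); first exact: bounded_near0_cst.
by exists 1 => // h _; rewrite !mul0r !addr0.
Qed.

Lemma jet2_id p : jet2 id p.
Proof.
exists 1, 0, (fun=> 0); first exact: bounded_near0_cst.
by exists 1 => // h _; rewrite !mul0r !addr0 mul1r.
Qed.

Ltac bnd := repeat first [ assumption | apply: bounded_near0_cst
  | apply: bounded_near0_id | apply: bounded_near0D | apply: bounded_near0M ].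

Lemma jet2D f g p : jet2 f p -> jet2 g p -> jet2 (fun z => f z + g z) p.
Proof.
move=> [b [c [r br fE]]] [b' [c' [r' br' gE]]].
exists (b + b'), (c + c'), (fun h => r h + r' h); first by bnd.
by apply: near0_imp (near0_and fE gE) => h [-> ->]; ring.
Qed.

Lemma jet2M f g p : jet2 f p -> jet2 g p -> jet2 (fun z => f z * g z) p.
Proof.
move=> [b [c [r br fE]]] [b' [c' [r' br' gE]]].
exists (f p * b' + b * g p), (f p * c' + b * b' + c * g p),
  (fun h => r h * g p + f p * r' h + b * c' + c * b'
            + (c * c' + b * r' h + r h * b') * h
            + (c * r' h + r h * c') * (h * h) + r h * r' h * (h * (h * h))).
  by bnd.
by apply: near0_imp (near0_and fE gE) => h [-> ->]; ring.
Qed.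

Lemma jet2N f p : jet2 f p -> jet2 (fun z => - f z) p.
Proof.
move=> jf; apply: (@jet2_near (fun z => (-1) * f z)).
  by exists 1 => // h _; rewrite mulN1r.
by apply: jet2M => //; exact: jet2_cst.
Qed.

Lemma jet2B f g p : jet2 f p -> jet2 g p -> jet2 (fun z => f z - g z) p.
Proof. by move=> jf jg; apply: jet2D => //; exact: jet2N. Qed.

Lemma jet2X f p n : jet2 f p -> jet2 (fun z => f z ^+ n) p.
Proof.
move=> jf; elim: n => [|n IH].
  by under eq_fun do rewrite expr0; exact: jet2_cst.
by under eq_fun do rewrite exprS; exact: jet2M.
Qed.

Lemma jet2_lip f p : jet2 f p ->
  exists2 L, 0 < L & near0 (fun h => normc (f (p + h) - f p) <= L * normc h).
Proof.
move=> [b [c [r br fE]]].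
have [M Mb] : bounded_near0 (fun h => b + c * h + r h * (h * h)) by bnd.
exists (Num.max M 1); first by rewrite lt_max ltr01 orbT.
apply: near0_imp (near0_and fE Mb) => h [-> hM].
have -> : f p + b * h + c * h ^+ 2 + r h * h ^+ 3 - f p =
  (b + c * h + r h * (h * h)) * h by ring.
by rewrite normcM ler_wpM2r ?normc_ge0// le_max hM.
Qed.

Lemma jet2_near_near0 f p (P : C -> Prop) : jet2 f p ->
  near0 (fun k => P (f p + k)) -> near0 (fun h => P (f (p + h))).
Proof.
move=> /jet2_lip[L L0 fL] [d d0 Pd].
have dL : 0 < d / L by rewrite divr_gt0.
apply: near0_imp (near0_and fL (near0_lt dL)) => h [hL hd].
rewrite -[f (p + h)](addrNK (f p)) addrC; apply: Pd.
by rewrite (le_lt_trans hL)// mulrC -ltr_pdivlMr.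
Qed.

(** Writing the increment of [f] as [h * k h] with [k] bounded, the expansion of
    [g] in powers of this increment has a remainder divisible by [h ^+ 3]. *)
Lemma jet2_comp g f p : jet2 g (f p) -> jet2 f p -> jet2 (fun z => g (f z)) p.
Proof.
move=> [b' [c' [r' [M' br'] gE]]] jf; have [b [c [r br fE]]] := jf.
have nE := jet2_near_near0 (P := fun w => g w = g (f p) + b' * (w - f p) +
  c' * (w - f p) ^+ 2 + r' (w - f p) * (w - f p) ^+ 3) jf.
have /nE{}nE : near0 (fun k => g (f p + k) = g (f p) + b' * (f p + k - f p) +
  c' * (f p + k - f p) ^+ 2 + r' (f p + k - f p) * (f p + k - f p) ^+ 3).
  by apply: near0_imp gE => k; rewrite [f p + k - f p]addrAC subrr add0r.
have nb := jet2_near_near0 (P := fun w => normc (r' (w - f p)) <= M') jf.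
have /nb{}nb : near0 (fun k => normc (r' (f p + k - f p)) <= M').
  by apply: near0_imp br' => k; rewrite [f p + k - f p]addrAC subrr add0r.
have b2 : bounded_near0 (fun h => r' (f (p + h) - f p)) by exists M'.
pose k h := b + c * h + r h * (h * h).
exists (b' * b), (b' * c + c' * b ^+ 2),
  (fun h => b' * r h + c' * ((b * c + b * c) + (c * c + (b * r h + b * r h)) * h
     + (c * r h + c * r h) * (h * h) + r h * r h * (h * (h * h)))
     + r' (f (p + h) - f p) * (k h * (k h * k h))).
  by rewrite /k; bnd.
apply: near0_imp (near0_and nE fE) => h [-> fh].
set rr := r' _; have -> : f (p + h) - f p = h * k h by rewrite fh /k; ring.
by rewrite /k; ring.
Qed.

Lemma jet2_inv p : p != 0 -> jet2 (fun z => z^-1) p.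
Proof.
move=> p0; exists (- p ^- 2), (p ^- 3), (fun h => - p ^- 3 * (p + h)^-1).
  apply: bounded_near0M; first exact: bounded_near0_cst.
  exists (2 / normc p), (normc p / 2) => [|h hp].
    by rewrite divr_gt0// normc_gt0.
  rewrite normcV -[2 / _]invf_div lef_pV2 ?posrE ?divr_gt0 ?normc_gt0//.
    by have := normc_triangle_rev p h; lra.
  apply/eqP => ph; have := normc_triangle_rev p h; rewrite ph normc0.
  by have := normc_gt0 p; rewrite p0; lra.
exists (normc p) => [|h hp]; first by rewrite normc_gt0.
have ph0 : p + h != 0.
  rewrite -normc_gt0; have := normc_triangle_rev p h; lra.
by field; rewrite ph0.
Qed.

Lemma jet2V f p : f p != 0 -> jet2 f p -> jet2 (fun z => (f z)^-1) p.
Proof. by move=> fp0; apply: jet2_comp; exact: jet2_inv. Qed.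

End near_zero.

(** * The maximum principle *)

Section maximum_principle.
Context {R : realType}.
Local Notation C := R[i].

(** Compactness in the plane, read on coordinates so that the topology is that
    of a product of two real lines. *)
Definition ccompact (K : set C) :=
  compact [set p : R * R | K (p.1 +i* p.2)].

Definition sqn (z : C) : R := complex.Re z ^+ 2 + complex.Im z ^+ 2.

Lemma near0_nbhs (P : C -> Prop) (p : R * R) :
  near0 (fun h => P (p.1 +i* p.2 + h)) ->
  \forall q \near p, P (q.1 +i* q.2).
Proof.
move=> [d d0 Pd]; have d20 : 0 < d / 2 by rewrite divr_gt0.
near=> q.
have -> : q.1 +i* q.2 =
    p.1 +i* p.2 + ((q.1 - p.1) +i* (q.2 - p.2)).
  by apply: complexP => /=; ring.
apply: Pd; rewrite (le_lt_trans (normc_le_ReIm _))//=.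
have [h1 h2] : ball p (d / 2) q by near: q; exact: nbhsx_ballx.
rewrite [ltRHS](splitr d) ltrD//; rewrite distrC; [exact: h1|exact: h2].
Unshelve. all: by end_near. Qed.

Lemma jet2_continuous (f : C -> C) (p : R * R) : jet2 f (p.1 +i* p.2) ->
  {for p, continuous (fun q : R * R => sqn (f (q.1 +i* q.2)))}.
Proof.
move=> jf.
have [L L0 fL] := jet2_lip jf.
have cont (g : C -> R) : (forall z w, `|g z - g w| <= normc (z - w)) ->
    {for p, continuous (fun q : R * R => g (f (q.1 +i* q.2)))}.
  move=> g1; apply/cvgrPdist_le => e e0.
  apply: (near0_nbhs (P := fun z => `|g (f (p.1 +i* p.2)) - g (f z)| <= e)).
  have eL : 0 < e / L by rewrite divr_gt0.
  apply: near0_imp (near0_and fL (near0_lt eL)) => h [hL he].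
  rewrite distrC (le_trans (g1 _ _))// (le_trans hL)// mulrC.
  by rewrite -ler_pdivlMr// ltW.
rewrite /sqn; apply: cvgD; under eq_fun do rewrite expr2.
- apply: cvgM; apply: (cont (@complex.Re R)) => -[a b] [c d] /=;
    exact: (normc_Re ((a - c) +i* (b - d))).
- apply: cvgM; apply: (cont (@complex.Im R)) => -[a b] [c d] /=;
    exact: (normc_Im ((a - c) +i* (b - d))).
Qed.

(** Parseval's identity on the four points [d], [id], [-d], [-id]: the monomials
    of degree 0, 1 and 2 are orthogonal there. *)
Lemma sqn_parseval (A b c : C) (d : R) :
  sqn (A + b * d%:C + c * d%:C ^+ 2) + sqn (A + b * (0 +i* d) + c * (0 +i* d) ^+ 2)
  + sqn (A + b * (- d)%:C + c * (- d)%:C ^+ 2)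
  + sqn (A + b * (0 +i* - d) + c * (0 +i* - d) ^+ 2) =
  4 * (sqn A + d ^+ 2 * sqn b + d ^+ 4 * sqn c).
Proof.
case: A b c => [a1 a2] [b1 b2] [c1 c2].
by rewrite /sqn /= !expr2 /=; ring.
Qed.

Lemma sqn_addr (x y : C) : sqn x - 2 * normc x * normc y <= sqn (x + y).
Proof.
rewrite /sqn -!normc_sqr.
have h := normc_triangle_rev x y; have h' := normc_triangle_rev y x.
rewrite [y + x]addrC in h'.
have := normc_ge0 x; have := normc_ge0 y; have := normc_ge0 (x + y).
have a : 0 <= normc (x + y) - (normc x - normc y) by lra.
have b : 0 <= normc (x + y) + (normc x - normc y) by lra.
have := mulr_ge0 a b; have := sqr_ge0 (normc y).
by rewrite !expr2; lra.
Qed.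

(** A maximum modulus principle for functions with 2-jets. The mean of [|g|^2]
    over four points around [p] is at least [|g p|^2] up to a cubic error
    ([sqn_parseval]), so that the penalised function [|g|^2 + eps |z|^2] has no
    interior maximum; then [eps] tends to 0. *)
Lemma maximum_principle (K : set C) (g : C -> C) (m : R) : ccompact K ->
  (forall p, K p -> jet2 g p) ->
  (forall p, K p -> normc (g p) <= m \/ near0 (fun h => K (p + h))) ->
  forall p, K p -> normc (g p) <= m.
Proof.
move=> cK jg bd p0 Kp0.
have cu eps : exists2 p : C, K p & forall q, K q ->
    sqn (g q) + eps * sqn q <= sqn (g p) + eps * sqn p.
  have [||p /set_mem Kp pmax] := @compact_EVT_max (R * R)%type R
     (fun q => sqn (g (q.1 +i* q.2)) + eps * sqn (q.1 +i* q.2))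
     [set p : R * R | K (p.1 +i* p.2)] _ cK.
  - by exists (complex.Re p0, complex.Im p0) => /=; case: (p0) Kp0.
  - apply: continuous_in_subspaceT => q /set_mem Kq.
    apply: cvgD; first by apply: jet2_continuous; exact: jg.
    apply: cvgM; first exact: cvg_cst.
    exact: (@jet2_continuous id _ (jet2_id _)).
  - exists (p.1 +i* p.2) => // -[x y] Kq; apply: (pmax (x, y)).
    exact/mem_set.
(* At an interior maximum p the mean of the penalised function over the four
   points p +- t, p +- it exceeds its value at p by at least eps * t^2, up to a
   cubic error: so the maximum sits where |g| <= m. *)
have step eps : 0 < eps -> exists2 p : C, normc (g p) <= m /\ K p &
    forall q, K q ->
    sqn (g q) + eps * sqn q <= sqn (g p) + eps * sqn p.
  move=> e0; have [p Kp pmax] := cu eps; exists p => //; split=> //.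
  have [//|nK] := bd _ Kp; exfalso.
  have [b [c [r [M rM] gE]]] := jg _ Kp.
  have [d d0 H] := near0_and nK (near0_and rM gE).
  pose N := normc (g p) + normc b + normc c.
  have N0 : 0 <= N by rewrite !addr_ge0 ?normc_ge0.
  have M0 : 0 <= M.
    have [] := H 0; first by rewrite normc0.
    by move=> _ [+ _]; apply: le_trans; exact: normc_ge0.
  (* eps * t^2 has to beat the cubic error 2 * N * M * t^3 *)
  pose t := Num.min (Num.min (d / 2) 1) (eps / (2 * (N * M + 1))).
  have t0 : 0 < t.
    rewrite !lt_min divr_gt0//= ltr01 divr_gt0// mulr_gt0// ltr_wpDl//.
    exact: mulr_ge0.
  have td : t < d.
    rewrite (le_lt_trans (_ : _ <= d / 2))//; last by lra.
    by rewrite /t !ge_min lexx.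
  have t1 : t <= 1 by rewrite /t !ge_min lexx orbT.
  have te : t * (2 * (N * M + 1)) <= eps.
    rewrite -ler_pdivlMr ?mulr_gt0// ?ltr_wpDl ?mulr_ge0//.
    by rewrite /t ge_min lexx orbT.
  have key h : normc h = t ->
     sqn (g p + b * h + c * h ^+ 2) - 2 * N * (M * t ^+ 3) + eps * sqn (p + h)
        <= sqn (g p) + eps * sqn p.
    move=> ht; have hd : normc h < d by rewrite ht.
    have [Kh [rh gh]] := H h hd.
    apply: le_trans (pmax _ Kh).
    rewrite lerD2r gh; apply: le_trans (sqn_addr _ _).
    rewrite lerD2l lerN2 -mulrA -[leRHS]mulrA.
    rewrite ler_wpM2l//; apply: ler_pM; rewrite ?normc_ge0//.
      rewrite (le_trans (normcD_le _ _))// lerD//.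
        rewrite (le_trans (normcD_le _ _))// lerD// normcM ht.
        by rewrite ler_piMr ?normc_ge0.
      by rewrite normcM normcX ht ler_piMr ?normc_ge0// exprn_ile1// ltW.
    by rewrite normcM normcX ht ler_wpM2r// exprn_ge0// ltW.
  have k1 := key (t%:C); have k2 := key (0 +i* t).
  have k3 := key ((- t)%:C); have k4 := key (0 +i* (- t)).
  have nt : normc (t%:C) = t by rewrite normc_real gtr0_norm.
  have nt' : normc ((- t)%:C) = t by rewrite normc_real normrN gtr0_norm.
  have nit : normc (0 +i* t) = t.
    by rewrite /= expr0n /= add0r sqrtr_sqr gtr0_norm.
  have nit' : normc (0 +i* - t) = t.
    by rewrite /= expr0n /= add0r sqrtr_sqr normrN gtr0_norm.
  have {k1 k2 k3 k4 key} := (k1 nt, k2 nit, k3 nt', k4 nit').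
  move=> [[[]]].
  have sb : 0 <= t ^+ 2 * sqn b.
    by rewrite mulr_ge0 ?sqr_ge0// addr_ge0 ?sqr_ge0.
  have sc : 0 <= t ^+ 4 * sqn c.
    by rewrite mulr_ge0 ?exprn_even_ge0// addr_ge0 ?sqr_ge0.
  have := sqn_parseval (g p) b c t.
  set s1 := sqn (_ + _ + _); set s2 := sqn (_ + _ + _).
  set s3 := sqn (_ + _ + _); set s4 := sqn (_ + _ + _).
  have -> : sqn (p + t%:C) = sqn p + 2 * complex.Re p * t + t ^+ 2.
    by case: (p) => x y; rewrite /sqn /=; ring.
  have -> : sqn (p + (-t)%:C) = sqn p - 2 * complex.Re p * t + t ^+ 2.
    by case: (p) => x y; rewrite /sqn /=; ring.
  have -> : sqn (p + (0 +i* t)) = sqn p + 2 * complex.Im p * t + t ^+ 2.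
    by case: (p) => x y; rewrite /sqn /=; ring.
  have -> : sqn (p + (0 +i* - t)) = sqn p - 2 * complex.Im p * t + t ^+ 2.
    by case: (p) => x y; rewrite /sqn /=; ring.
  move=> P4 k1 k2 k3 k4.
  have : eps * t ^+ 2 <= 2 * N * (M * t ^+ 3) by lra.
  apply/negP; rewrite -ltNge.
  have -> : 2 * N * (M * t ^+ 3) = (t * (2 * (N * M))) * t ^+ 2 by ring.
  rewrite ltr_pM2r ?exprn_gt0//; apply: lt_le_trans te.
  by rewrite ltr_pM2l// ltr_pM2l// ltrDl ltr01.
have m0 : 0 <= m.
  have [p [gp _] _] := step 1 ltr01; exact: le_trans (normc_ge0 _) gp.
have [L Lmax] : exists L, forall q, K q -> sqn q <= L.
  have [||p /set_mem Kp pmax] := @compact_EVT_max (R * R)%type R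
     (fun q => sqn (q.1 +i* q.2))
     [set p : R * R | K (p.1 +i* p.2)] _ cK.
  - by exists (complex.Re p0, complex.Im p0) => /=; case: (p0) Kp0.
  - apply: continuous_in_subspaceT => q /set_mem Kq.
    exact: (@jet2_continuous id _ (jet2_id _)).
  - exists (sqn (p.1 +i* p.2)) => -[x y] Kq; apply: (pmax (x, y)).
    exact/mem_set.
have L0 : 0 <= L by apply: le_trans (Lmax _ Kp0); rewrite addr_ge0 ?sqr_ge0.
rewrite -(@ler_pXn2r _ 2) ?nnegrE ?normc_ge0//.
apply/ler_addgt0Pr => e e0.
have e1 : 0 < e / (L + 1) by rewrite divr_gt0// ltr_wpDl.
have [p [gp Kp] /(_ _ Kp0)] := step _ e1.
rewrite /sqn -!normc_sqr => pm.
have : normc (g p) ^+ 2 <= m ^+ 2 by rewrite lerXn2r ?nnegrE ?normc_ge0.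
have : e / (L + 1) * normc p ^+ 2 <= e.
  rewrite mulrAC ler_pdivrMr ?ltr_wpDl// ler_pM2l//.
  by rewrite normc_sqr (le_trans (Lmax _ Kp))// lerDl.
have : 0 <= e / (L + 1) * normc p0 ^+ 2 by rewrite mulr_ge0 ?sqr_ge0// ltW.
lra.
Qed.

End maximum_principle.

(** * Open mapping and identity theorems *)

Section identity_theorem.
Context {R : realType}.
Local Notation C := R[i].

Lemma nbhs_near0 (P : R * R -> Prop) (p : C) :
  (\forall q \near (complex.Re p, complex.Im p), P q) ->
  near0 (fun h => P (complex.Re (p + h), complex.Im (p + h))).
Proof.
move=> /nbhs_ballP[e /= e0 eP]; exists e => // h he; apply: eP.
case: p h he => x y [a b] he; split=> /=; rewrite /ball /= opprD addNKr normrN.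
- exact: le_lt_trans (normc_Re (a +i* b)) he.
- exact: le_lt_trans (normc_Im (a +i* b)) he.
Qed.

Lemma ccompact_sublevel (k : C -> R) (L : R) :
  continuous (fun q : R * R => k (q.1 +i* q.2)) ->
  (forall z, k z <= 0 -> normc z <= L) ->
  ccompact [set z | k z <= 0].
Proof.
move=> ck kL; apply: (@subclosed_compact _ _ (`[- L, L] `*` `[- L, L])).
- exact: (closed_comp (fun x _ => ck x) (@closed_le R 0)).
- by apply: compact_setX; exact: segment_compact.
- move=> [x y] /= /kL hL; rewrite !in_itv /= -!ler_norml.
  have := normc_Re (x +i* y); have := normc_Im (x +i* y).
  by move=> /= h1 h2; rewrite !(le_trans _ hL).
Qed.

Lemma sublevel_near0 (k : C -> R) p :
  continuous (fun q : R * R => k (q.1 +i* q.2)) -> k p < 0 ->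
  near0 (fun h => k (p + h) <= 0).
Proof.
move=> ck kp.
have H := @nbhs_near0 (fun q : R * R => k (q.1 +i* q.2) <= 0) p.
apply: near0_imp (H _) => [h /=|]; first by case: (p + h).
have := ck (complex.Re p, complex.Im p).
move=> /cvgr_le; apply => /=; by case: p kp {H}.
Qed.

Lemma continuous_sqn_jet (f : C -> C) : (forall z, jet2 f z) ->
  continuous (fun q : R * R => sqn (f (q.1 +i* q.2))).
Proof. by move=> jf q; apply: jet2_continuous. Qed.

Lemma continuous_sqnB (a : C) :
  continuous (fun q : R * R => sqn (q.1 +i* q.2 - a)).
Proof.
apply: (@continuous_sqn_jet (fun z => z - a)) => z.
by apply: jet2B; [exact: jet2_id|exact: jet2_cst].
Qed.

Lemma sqnE (z : C) : sqn z = normc z ^+ 2. Proof. by rewrite normc_sqr. Qed.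

Lemma ccompact_disc (a : C) (r : R) : 0 <= r ->
  ccompact [set z | normc (z - a) <= r].
Proof.
move=> r0.
have -> : [set z | normc (z - a) <= r] = [set z | sqn (z - a) - r ^+ 2 <= 0].
  apply/seteqP; split => z /=; rewrite subr_le0 sqnE;
    by rewrite ler_pXn2r ?nnegrE ?normc_ge0.
apply: (@ccompact_sublevel _ (r + normc a)) => [q|z].
  by apply: cvgB; [exact: continuous_sqnB|exact: cvg_cst].
rewrite subr_le0 sqnE ler_pXn2r ?nnegrE ?normc_ge0// => h.
by have := normc_triangle_rev z (- a); rewrite normc_opp; lra.
Qed.

(** The maximum principle for [1 / (H - v)]: if [H] stays at distance [c] from
    [H w0] on the circle, then it takes on the disc every value [v] at distance
    less than [c / 2] from [H w0]. *)
Lemma open_mapping (H : C -> C) (w0 : C) (r c : R) : 0 < r -> 0 < c ->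
  (forall w, normc (w - w0) <= r -> jet2 H w) ->
  (forall w, normc (w - w0) = r -> c <= normc (H w - H w0)) ->
  near0 (fun h => exists2 w, normc (w - w0) <= r & H w = H w0 + h).
Proof.
move=> r0 c0 jH bH; exists (c / 2) => [|h hc]; first by rewrite divr_gt0.
apply: contrapT => nex.
have Hne w : normc (w - w0) <= r -> H w - (H w0 + h) != 0.
  by move=> wr; rewrite subr_eq0; apply: contra_notN nex => /eqP ?; exists w.
have h0 : h != 0.
  have := Hne w0; rewrite subrr normc0 opprD addrA subrr add0r oppr_eq0.
  by apply; exact: ltW.
(* A missed value makes 1 / (H - value) holomorphic on the disc, with a larger
   modulus at the centre than on the boundary. *)
pose g w := (H w - (H w0 + h))^-1.
have w0in : normc (w0 - w0) <= r by rewrite subrr normc0 ltW.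
have := @maximum_principle R [set w | normc (w - w0) <= r] g (2 / c)
  (@ccompact_disc w0 r (ltW r0)) _ _ w0 w0in.
have : ~ normc (g w0) <= 2 / c.
  apply/negP; rewrite -ltNge /g opprD addrA subrr add0r normcV normc_opp.
  by rewrite -[2 / c]invf_div ltf_pV2 ?posrE ?divr_gt0 ?normc_gt0.
move=> + mp; apply; apply: mp => [w wr|w /= wr].
  apply: jet2V; first exact: Hne.
  by apply: jet2B; [exact: jH|exact: jet2_cst].
have [/eqP wE|ne] := boolP (normc (w - w0) == r).
  left; rewrite /g normcV -[2 / c]invf_div lef_pV2 ?posrE ?divr_gt0//.
    have := normc_triangle_rev (H w - H w0) (- h); have := bH _ wE.
    by rewrite normc_opp opprD addrA; lra.
  by rewrite normc_gt0 Hne.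
right; have wr' : 0 < r - normc (w - w0) by rewrite subr_gt0 lt_neqAle ne.
exists (r - normc (w - w0)) => // k kr.
by rewrite addrAC (le_trans (normcD_le _ _))//; lra.
Qed.

Lemma sqn_conj (z a : C) : sqn (z - conjc a) =
  sqn (z - a) + 4 * complex.Im z * complex.Im a.
Proof. by case: z a => x y [u v]; rewrite /sqn /=; ring. Qed.

Lemma jet2_bounded (K : set C) (f : C -> C) : ccompact K ->
  (forall z, K z -> jet2 f z) ->
  exists2 M, 0 <= M & forall z, K z -> normc (f z) <= M.
Proof.
move=> cK jf; have [[p0 Kp0]|nK] := pselect (exists p, K p); last first.
  by exists 0 => // z Kz; exfalso; apply: nK; exists z.
have [||p /set_mem Kp pmax] := @compact_EVT_max (R * R)%type R
     (fun q => sqn (f (q.1 +i* q.2)))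
     [set p : R * R | K (p.1 +i* p.2)] _ cK.
- by exists (complex.Re p0, complex.Im p0) => /=; case: (p0) Kp0.
- apply: continuous_in_subspaceT => q /set_mem Kq.
  by apply: jet2_continuous; exact: jf.
- exists (normc (f (p.1 +i* p.2))); rewrite ?normc_ge0// => -[x y] Kz.
  rewrite -(@ler_pXn2r _ 2) ?nnegrE ?normc_ge0// -!sqnE.
  by apply: (pmax (x, y)); exact/mem_set.
Qed.

(** Let [B] be the Blaschke factor of the upper half-plane vanishing at [z0].
    The functions [f / B ^ n] extend by 0 near [z0], and the maximum principle
    on [|B| <= q] gives [|f| <= M (|B| / q) ^ n], which tends to 0 where [|B| <
    q]. *)
Lemma identity_theorem (f : C -> C) (z0 : C) :
  (forall z, 0 < complex.Im z -> jet2 f z) -> 0 < complex.Im z0 ->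
  near0 (fun h => f (z0 + h) = 0) ->
  forall z, 0 < complex.Im z -> f z = 0.
Proof.
move=> jf y0 f0 z1 y1.
have [->|z10] := eqVneq z1 z0.
  by case: f0 => d d0 /(_ 0); rewrite addr0; apply; rewrite normc0.
have bar_gt0 z : 0 < complex.Im z -> 0 < normc (z - conjc z0).
  move=> yz; rewrite -(@ltr_pXn2r _ 2) ?nnegrE ?normc_ge0// expr0n /= -sqnE.
  by rewrite sqn_conj ltr_wpDl ?addr_ge0 ?sqr_ge0// !mulr_gt0.
(* b is the modulus at z1 of the Blaschke factor with zero z0; any q strictly
   between b and 1 would do. *)
pose b := normc (z1 - z0) / normc (z1 - conjc z0).
have b0 : 0 < b by rewrite divr_gt0 ?bar_gt0// normc_gt0 subr_eq0.
have b1 : b < 1.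
  rewrite ltr_pdivrMr ?bar_gt0// mul1r -(@ltr_pXn2r _ 2) ?nnegrE ?normc_ge0//.
  by rewrite -!sqnE sqn_conj ltrDl !mulr_gt0.
pose q := (b + 1) / 2.
have q0 : 0 < q by rewrite /q; lra.
have q1 : q < 1 by rewrite /q; lra.
have bq : b < q by rewrite /q; lra.
clearbody q.
(* {k <= 0} is the hyperbolic disc where the Blaschke factor is at most q;
   squares are used so that k is polynomial in the coordinates *)
pose k z := sqn (z - z0) - q ^+ 2 * sqn (z - conjc z0).
have kE z : (k z <= 0) = (normc (z - z0) <= q * normc (z - conjc z0)).
  rewrite /k subr_le0 !sqnE -exprMn ler_pXn2r ?nnegrE ?normc_ge0//.
  by rewrite mulr_ge0 ?normc_ge0// ltW.
have ck : continuous (fun p : R * R => k (p.1 +i* p.2)).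
  move=> p; apply: cvgB; first exact: continuous_sqnB.
  by apply: cvgM; [exact: cvg_cst|exact: continuous_sqnB].
pose K := [set z | k z <= 0].
have Kpos z : K z -> 0 < complex.Im z.
  rewrite /K /= /k sqn_conj ltNge => kz; apply/negP => yz.
  have s0 : 0 <= sqn (z - z0) by rewrite addr_ge0 ?sqr_ge0.
  have q21 : q ^+ 2 < 1 by rewrite expr_lt1// ltW.
  have q20 : 0 < q ^+ 2 by rewrite exprn_gt0.
  have h1 : 0 <= (1 - q ^+ 2) * sqn (z - z0) by rewrite mulr_ge0// ; lra.
  have h2 : 0 <= q ^+ 2 * (4 * - complex.Im z * complex.Im z0).
    apply: mulr_ge0; first exact: sqr_ge0.
    by apply: mulr_ge0; [rewrite mulr_ge0 ?oppr_ge0|exact: ltW].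
  have h3 : (1 - q ^+ 2) * sqn (z - z0) = 0 by lra.
  move/eqP: h3; rewrite mulf_eq0 => /orP[/eqP|]; first by lra.
  rewrite sqnE sqrf_eq0 => /eqP/eq0_normc/eqP; rewrite subr_eq0 => /eqP zz.
  by move: yz; rewrite zz; lra.
have cK : ccompact K.
  apply: (@ccompact_sublevel k (normc z0 + 2 * complex.Im z0 / (1 - q))) => // z.
  rewrite kE => kz.
  have h1 : normc (z - conjc z0) <= normc (z - z0) + 2 * complex.Im z0.
    have -> : z - conjc z0 = (z - z0) + 0 +i* (2 * complex.Im z0).
      by case: (z) (z0) => ? ? [? ?]; apply: complexP => /=; ring.
    rewrite (le_trans (normcD_le _ _))// lerD2l /= expr0n /= add0r sqrtr_sqr.
    by rewrite ger0_norm// mulr_ge0// ltW.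
  have h2 : normc (z - z0) <= 2 * complex.Im z0 / (1 - q).
    rewrite ler_pdivlMr ?subr_gt0// mulrBr mulr1.
    have : q * normc (z - conjc z0) <= q * normc (z - z0) + 2 * complex.Im z0.
      rewrite (le_trans (ler_wpM2l (ltW q0) h1))// mulrDr lerD2l.
      by rewrite ger_pMl// ?mulr_gt0// ltW.
    by lra.
  have := normc_triangle_rev z (- z0); rewrite normc_opp; lra.
have [M M0 fM] := jet2_bounded cK (fun z Kz => jf z (Kpos z Kz)).
have Kz1 : K z1.
  by rewrite /K /= kE -ler_pdivrMr ?bar_gt0// ltW.
have est n : normc (f z1) <= M * (b / q) ^+ n.
  pose g z := f z * ((z - conjc z0) / (z - z0)) ^+ n.
  have jg z : K z -> jet2 g z.
    move=> Kz; have [->|zz0] := eqVneq z z0.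
      apply: (@jet2_near _ (fun=> 0)); last exact: jet2_cst.
      by apply: near0_imp f0 => h fh; rewrite /g fh mul0r.
    apply: jet2M; first exact: jf (Kpos _ Kz).
    apply: jet2X; apply: jet2M.
      by apply: jet2B; [exact: jet2_id|exact: jet2_cst].
    apply: jet2V; first by rewrite subr_eq0.
    by apply: jet2B; [exact: jet2_id|exact: jet2_cst].
  have := @maximum_principle R K g (M * q ^- n) cK jg _ z1 Kz1.
  rewrite /g normcM normcX normcM normcV => gb.
  have : normc (f z1) * (normc (z1 - conjc z0) / normc (z1 - z0)) ^+ n
          <= M * q ^- n.
    apply: gb => z Kz; have [kz|kz] := boolP (k z < 0).
      by right; exact: sublevel_near0.
    left; rewrite /g normcM normcX normcM normcV.
    have kz0 : k z == 0 by rewrite eq_le Kz leNgt.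
    have E : normc (z - z0) = q * normc (z - conjc z0).
      have qn := mulr_ge0 (ltW q0) (normc_ge0 (z - conjc z0)).
      apply/eqP; rewrite -(@eqrXn2 _ 2) ?normc_ge0//.
      by rewrite exprMn -!sqnE -subr_eq0.
    have n0 : normc (z - conjc z0) != 0 by rewrite gt_eqF// bar_gt0// Kpos.
        have -> : normc (z - conjc z0) / normc (z - z0) = q^-1.
      by rewrite E invfM mulrCA divff// mulr1.
    by rewrite exprVn ler_wpM2r ?fM// invr_ge0 exprn_ge0// ltW.
  rewrite -[_ / normc (z1 - z0)]invf_div -/b exprVn ler_pdivrMr ?exprn_gt0//.
  by rewrite mulrAC -mulrA -expr_div_n.
have bq1 : `|b / q| < 1.
  rewrite gtr0_norm; last exact: (divr_gt0 b0 q0).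
  by rewrite ltr_pdivrMr// mul1r.
have lim : (fun n => M * (b / q) ^+ n) @ \oo --> M * 0.
  by apply: cvgM; [exact: cvg_cst|exact: cvg_expr].
have : normc (f z1) <= M * 0.
  rewrite -(cvg_lim (@Rhausdorff R) lim); apply: limr_ge.
    by apply/cvg_ex; eexists; exact: lim.
  by near=> n; exact: est.
rewrite mulr0 => f1; apply: eq0_normc; apply/eqP.
by rewrite eq_le f1 normc_ge0.
Unshelve. all: by end_near. Qed.

End identity_theorem.

(** * Integrals of complex functions *)

Section complex_integration.
Context {R : realType}.
Local Notation C := R[i].
Local Notation mR := (measurableTypeR R).
Implicit Types (m : {measure set mR -> \bar R}) (f g : mR -> C).

Local Notation Rintegrable m f := (m.-integrable setT (EFin \o (f : mR -> R))).

Definition cmeasurable f :=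
  measurable_fun setT (fun t => complex.Re (f t)) /\
  measurable_fun setT (fun t => complex.Im (f t)).

Definition cintegrable m f :=
  Rintegrable m (fun t => complex.Re (f t)) /\
  Rintegrable m (fun t => complex.Im (f t)).

Lemma measurable_invr : measurable_fun setT (fun x : R => x^-1).
Proof.
have -> : [set: R] = [set x | x != 0] `|` [set 0].
  apply/seteqP; split => x //= _; have [->|] := eqVneq x 0; [by right|by left].
have o : open [set x : R | x != 0] by exact: open_neq.
apply/measurable_funU; [exact: open_measurable|exact: measurable_set1|split].
  by apply: open_continuous_measurable_fun => // x; rewrite inE; exact: inv_continuous.
apply: (eq_measurable_fun (cst (0 : R))); last exact: measurable_cst.
by move=> x; rewrite inE => ->; rewrite /= invr0.
Qed.

Lemma cReV (z : C) : complex.Re z^-1 = complex.Re z / sqn z.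
Proof. by case: z. Qed.

Lemma cImV (z : C) : complex.Im z^-1 = - complex.Im z / sqn z.
Proof. by case: z => a b; rewrite mulNr. Qed.

Lemma cReM (z w : C) :
  complex.Re (z * w) = complex.Re z * complex.Re w - complex.Im z * complex.Im w.
Proof. by case: z w => a b [c d]. Qed.

Lemma cImM (z w : C) :
  complex.Im (z * w) = complex.Re z * complex.Im w + complex.Im z * complex.Re w.
Proof. by case: z w => a b [c d]. Qed.

Lemma cReD (z w : C) : complex.Re (z + w) = complex.Re z + complex.Re w.
Proof. by case: z w => a b [c d]. Qed.

Lemma cImD (z w : C) : complex.Im (z + w) = complex.Im z + complex.Im w.
Proof. by case: z w => a b [c d]. Qed.

Lemma cmeasurable_cst c : cmeasurable (fun=> c).
Proof. by split; exact: measurable_cst. Qed.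

Lemma cmeasurable_real (f : mR -> R) : measurable_fun setT f ->
  cmeasurable (fun t => (f t)%:C).
Proof. by move=> mf; split => //; exact: measurable_cst. Qed.

Lemma cmeasurableD f g : cmeasurable f -> cmeasurable g ->
  cmeasurable (fun t => f t + g t).
Proof.
move=> [f1 f2] [g1 g2]; split.
  by under eq_fun do rewrite cReD; exact: measurable_funD.
by under eq_fun do rewrite cImD; exact: measurable_funD.
Qed.

Lemma cmeasurableM f g : cmeasurable f -> cmeasurable g ->
  cmeasurable (fun t => f t * g t).
Proof.
move=> [f1 f2] [g1 g2]; split.
  under eq_fun do rewrite cReM.
  by apply: measurable_funB; apply: measurable_funM.
under eq_fun do rewrite cImM.
by apply: measurable_funD; apply: measurable_funM.
Qed.

Lemma cmeasurableN f : cmeasurable f -> cmeasurable (fun t => - f t).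
Proof.
move=> mf; under eq_fun do rewrite -mulN1r.
by apply: cmeasurableM => //; exact: cmeasurable_cst.
Qed.

Lemma measurable_sqn f : cmeasurable f -> measurable_fun setT (fun t => sqn (f t)).
Proof. by move=> [f1 f2]; apply: measurable_funD; exact: measurable_funX. Qed.

Lemma measurable_normc f : cmeasurable f ->
  measurable_fun setT (fun t => normc (f t)).
Proof.
move=> mf.
have -> : (fun t => normc (f t)) = (fun t => Num.sqrt (sqn (f t))).
  by apply/funext => t; case: (f t).
apply: (@measurableT_comp _ _ _ _ _ _ (@Num.sqrt R)).
  by apply: continuous_measurable_fun; exact: sqrt_continuous.
exact: measurable_sqn.
Qed.

Lemma cmeasurableV f : cmeasurable f -> cmeasurable (fun t => (f t)^-1).
Proof.
move=> mf; have mi : measurable_fun setT (fun t => (sqn (f t))^-1).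
  by apply: (@measurableT_comp _ _ _ _ _ _ (fun x : R => x^-1));
    [exact: measurable_invr|exact: measurable_sqn].
case: (mf) => f1 f2; split.
  by under eq_fun do rewrite cReV; exact: measurable_funM.
under eq_fun do rewrite cImV; apply: measurable_funM => //.
exact: measurableT_comp.
Qed.

Lemma Rintegrable_dom m (f g : mR -> R) : measurable_fun setT f ->
  (forall t, `|f t| <= g t) -> Rintegrable m g -> Rintegrable m f.
Proof.
move=> mf fg; apply: le_integrable => //.
  exact/measurable_EFinP.
move=> t _ /=; rewrite lee_fin (le_trans (fg t))//.
exact: ler_norm.
Qed.

Lemma Rintegrable_cst m (c : R) : (m setT < +oo)%E -> Rintegrable m (fun=> c).
Proof.
move=> mT; apply/integrableP; split; first exact: measurable_cst.
rewrite integral_cst//= lte_mul_pinfty ?lee_fin//.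
Qed.

Lemma cintegrable_dom m f (g : mR -> R) : cmeasurable f ->
  (forall t, normc (f t) <= g t) -> Rintegrable m g -> cintegrable m f.
Proof.
move=> [mf1 mf2] fg ig; split; apply: Rintegrable_dom ig => // t;
  apply: le_trans (fg t); [exact: normc_Re|exact: normc_Im].
Qed.

Lemma RintegrableD m (f g : mR -> R) : Rintegrable m f -> Rintegrable m g ->
  Rintegrable m (fun t => f t + g t).
Proof. by move=> fi gi; exact: (integrableD measurableT fi gi). Qed.

Lemma RintegrableZ m (f : mR -> R) c : Rintegrable m f ->
  Rintegrable m (fun t => c * f t).
Proof. by move=> fi; exact: (integrableZl measurableT c fi). Qed.

Lemma RintegrableB m (f g : mR -> R) : Rintegrable m f -> Rintegrable m g ->
  Rintegrable m (fun t => f t - g t).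
Proof. by move=> fi gi; exact: (integrableB measurableT fi gi). Qed.

Lemma cintegrableD m f g : cintegrable m f -> cintegrable m g ->
  cintegrable m (fun t => f t + g t).
Proof.
move=> [f1 f2] [g1 g2]; split.
  by under eq_fun do rewrite cReD; exact: RintegrableD.
by under eq_fun do rewrite cImD; exact: RintegrableD.
Qed.

Lemma cintegrableZ m f c : cintegrable m f -> cintegrable m (fun t => c * f t).
Proof.
move=> [f1 f2]; split.
  by under eq_fun do rewrite cReM; apply: RintegrableB; exact: RintegrableZ.
by under eq_fun do rewrite cImM; apply: RintegrableD; exact: RintegrableZ.
Qed.

Lemma eq_cintegral m f g : f =1 g -> cintegral m f = cintegral m g.
Proof. by move=> /funext ->. Qed.

Lemma cintegralD m f g : cintegrable m f -> cintegrable m g ->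
  cintegral m (fun t => f t + g t) = cintegral m f + cintegral m g.
Proof.
move=> [f1 f2] [g1 g2]; apply: complexP => /=.
  by under eq_Rintegral do rewrite cReD; rewrite RintegralD.
by under eq_Rintegral do rewrite cImD; rewrite RintegralD.
Qed.

Lemma cintegralZ m f c : cintegrable m f ->
  cintegral m (fun t => c * f t) = c * cintegral m f.
Proof.
move=> [f1 f2]; apply: complexP; rewrite /= ?cReM ?cImM /=.
  under eq_Rintegral do rewrite cReM.
  by rewrite RintegralB//; [rewrite !RintegralZl|exact: RintegrableZ..].
under eq_Rintegral do rewrite cImM.
by rewrite RintegralD//; [rewrite !RintegralZl|exact: RintegrableZ..].
Qed.

(** The constant is 1: [kernel_slope_le] needs it, because the energies that it
    compares may be as close to 1 as one likes. *)
Lemma normc_cintegral_le m f (g : mR -> R) : cintegrable m f ->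
  Rintegrable m g -> (forall t, normc (f t) <= g t) ->
  normc (cintegral m f) <= Rintegral m setT g.
Proof.
move=> fi gi fg; set I := cintegral m f.
have [->|I0] := eqVneq I 0.
  by rewrite normc0 Rintegral_ge0// => t _; exact: (le_trans (normc_ge0 _) (fg t)).
have nI : 0 < normc I by rewrite normc_gt0.
(* c rotates the integral onto the positive half-line, which avoids losing a
   constant factor *)
pose c := (normc I)^-1%:C * conjc I.
have nc : normc c = 1.
  rewrite normcM normc_real ger0_norm ?invr_ge0 ?normc_ge0//.
  have -> : normc (conjc I) = normc I by case: (I) => a b /=; rewrite sqrrN.
  by rewrite mulVf// gt_eqF.
have <- : complex.Re (c * I) = normc I.
  rewrite /c -mulrA.
  have -> : conjc I * I = (normc I ^+ 2)%:C.
    by rewrite normc_sqr; case: (I) => a b; apply: complexP => /=; ring.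
  by rewrite -rmorphM /= expr2 mulrA mulVf ?mul1r// gt_eqF.
rewrite -cintegralZ//=; apply: le_Rintegral => //.
  by case: (cintegrableZ c fi).
move=> t _; rewrite (le_trans (ler_norm _))// (le_trans (normc_Re _))//.
by rewrite normcM nc mul1r.
Qed.

End complex_integration.

(** * Integral transforms of Cauchy type *)

Section kernel_transform.
Context {R : realType}.
Local Notation C := R[i].
Local Notation mR := (measurableTypeR R).
Local Notation Rintegrable m f := (m.-integrable setT (EFin \o (f : mR -> R))).
Variables (m : {measure set mR -> \bar R}) (p q : mR -> R).

(** Common form of the kernel of the Cauchy transform ([p = 1], [q = 0]) and of
    that of the free Levy-Khintchine representation; [q] compensates the part of
    [p t / (w - t)] that is not integrable and does not depend on [w]. *)
Definition cauchy_kernel (w : C) (t : mR) : C := (p t)%:C / (w - t%:C) + (q t)%:C.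

Definition kernel_transform (w : C) : C := cintegral m (cauchy_kernel w).

(** Minus the ratio of the imaginary parts of [kernel_transform w] and [w]. *)
Definition kernel_energy (w : C) : R :=
  Rintegral m setT (fun t => p t / sqn (w - t%:C)).

(** The opposite of the divided difference of [kernel_transform]. *)
Definition kernel_slope (w1 w2 : C) : C :=
  cintegral m (fun t => (p t)%:C / ((w1 - t%:C) * (w2 - t%:C))).

Hypotheses (mp : measurable_fun setT p) (p0 : forall t, 0 <= p t).
Hypothesis ik : forall w, 0 < complex.Im w -> cintegrable m (cauchy_kernel w).
Hypothesis ie : forall w, 0 < complex.Im w ->
  Rintegrable m (fun t => p t / sqn (w - t%:C)).

Implicit Types w : C.

Lemma subr_real_neq0 w (t : R) : 0 < complex.Im w -> w - t%:C != 0.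
Proof.
case: w => x y /= y0; apply/eqP => /(congr1 (@complex.Im R)) /=.
by rewrite subr0; lra.
Qed.

Lemma Im_le_normcB w (t : R) : complex.Im w <= normc (w - t%:C).
Proof.
have := normc_Im (w - t%:C); case: w => x y /=; rewrite subr0.
by apply: le_trans; exact: ler_norm.
Qed.

Lemma cmeasurable_line w : cmeasurable (fun t : mR => w - t%:C).
Proof.
apply: cmeasurableD; first exact: cmeasurable_cst.
by apply: cmeasurableN; apply: cmeasurable_real; exact: measurable_id.
Qed.

Lemma sqn_gt0 (z : C) : z != 0 -> 0 < sqn z.
Proof. by move=> z0; rewrite sqnE exprn_gt0// normc_gt0. Qed.

Lemma slope_density_le w1 w2 t : 0 < complex.Im w1 -> 0 < complex.Im w2 ->
  normc ((p t)%:C / ((w1 - t%:C) * (w2 - t%:C))) <=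
  2^-1 * (p t / sqn (w1 - t%:C) + p t / sqn (w2 - t%:C)).
Proof.
move=> /(@subr_real_neq0 _ t) z1 /(@subr_real_neq0 _ t) z2.
rewrite normcM normc_real ger0_norm// normcV normcM -mulrDr mulrCA.
rewrite ler_wpM2l// !sqnE invfM.
have a0 : 0 <= (normc (w1 - t%:C))^-1 by rewrite invr_ge0 normc_ge0.
have b0 : 0 <= (normc (w2 - t%:C))^-1 by rewrite invr_ge0 normc_ge0.
rewrite -!exprVn; move: a0 b0; set a := _^-1; set b := (normc _)^-1 => a0 b0.
by have := sqr_ge0 (a - b); rewrite sqrrB; lra.
Qed.

Lemma slope_density_integrable w1 w2 : 0 < complex.Im w1 -> 0 < complex.Im w2 ->
  Rintegrable m (fun t => 2^-1 * (p t / sqn (w1 - t%:C) + p t / sqn (w2 - t%:C))).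
Proof. by move=> y1 y2; apply: RintegrableZ; apply: RintegrableD; exact: ie. Qed.

Lemma slope_integrable w1 w2 : 0 < complex.Im w1 -> 0 < complex.Im w2 ->
  cintegrable m (fun t => (p t)%:C / ((w1 - t%:C) * (w2 - t%:C))).
Proof.
move=> y1 y2; apply: cintegrable_dom (slope_density_integrable y1 y2).
  apply: cmeasurableM; first exact: cmeasurable_real.
  by apply: cmeasurableV; apply: cmeasurableM; exact: cmeasurable_line.
by move=> t; exact: slope_density_le.
Qed.

(** The arithmetic-geometric inequality under the integral sign; it makes the
    right inverse injective where its energy is less than 1. *)
Lemma kernel_slope_le w1 w2 : 0 < complex.Im w1 -> 0 < complex.Im w2 ->
  normc (kernel_slope w1 w2) <= (kernel_energy w1 + kernel_energy w2) / 2.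
Proof.
move=> y1 y2; rewrite mulrC /kernel_energy -RintegralD//; [|exact: ie..].
rewrite -RintegralZl//; last by apply: RintegrableD; exact: ie.
apply: normc_cintegral_le => [||t]; [exact: slope_integrable| |exact: slope_density_le].
exact: slope_density_integrable.
Qed.

Lemma kernel_transformB w1 w2 : 0 < complex.Im w1 -> 0 < complex.Im w2 ->
  kernel_transform w1 - kernel_transform w2 =
  - (w1 - w2) * kernel_slope w1 w2.
Proof.
move=> y1 y2; apply/eqP; rewrite subr_eq; apply/eqP.
rewrite /kernel_slope -cintegralZ; last exact: slope_integrable.
rewrite -cintegralD; last exact: ik.
  apply: eq_cintegral => t; rewrite /cauchy_kernel.
  by field; rewrite !subr_real_neq0.
by apply: cintegrableZ; exact: slope_integrable.
Qed.

Lemma Im_kernel_transform w : 0 < complex.Im w ->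
  complex.Im (kernel_transform w) = - complex.Im w * kernel_energy w.
Proof.
move=> yw; rewrite /= /kernel_energy -RintegralZl//; last exact: ie.
apply: eq_Rintegral => t _; rewrite /cauchy_kernel cImD cImM cImV /=.
by case: w {yw} => x y /=; rewrite subr0; ring.
Qed.

Lemma kernel_energy_ge0 w : 0 <= kernel_energy w.
Proof.
apply: Rintegral_ge0 => t _; rewrite divr_ge0//.
by rewrite addr_ge0 ?sqr_ge0.
Qed.

(** The expansion of [1 / (w + h - t)] to order two, integrated term by term;
    the remainder is controlled by the energy at [w] for [|h| < Im w / 2]. *)
Lemma jet2_kernel_transform w : 0 < complex.Im w -> jet2 kernel_transform w.
Proof.
move=> yw; pose y := complex.Im w.
have mP (f : mR -> C) : cmeasurable f -> cmeasurable (fun t => (p t)%:C / f t).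
  move=> mf; apply: cmeasurableM; first exact: cmeasurable_real.
  exact: cmeasurableV.
(* Every integrand below is the energy density at w divided by a function
   bounded from below by a power of y. *)
have dom (f : mR -> C) c : cmeasurable f ->
    (forall t, y ^+ c.+1 * sqn (w - t%:C) <= 2 * normc (f t)) ->
    cintegrable m (fun t => (p t)%:C / f t) /\
    normc (cintegral m (fun t => (p t)%:C / f t)) <=
    2 / y ^+ c.+1 * kernel_energy w.
  move=> mf fw.
  have yc : 0 < y ^+ c.+1 by rewrite exprn_gt0.
  have sw t : 0 < sqn (w - t%:C) by rewrite sqn_gt0// subr_real_neq0.
  have le t : normc ((p t)%:C / f t) <= 2 / y ^+ c.+1 * (p t / sqn (w - t%:C)).
    rewrite normcM normc_real ger0_norm// mulrCA ler_wpM2l// normcV -[2 / _]invf_div.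
    rewrite -invfM lef_pV2 ?posrE ?mulr_gt0 ?divr_gt0//.
      by have := fw t; lra.
    have h : 0 < y ^+ c.+1 * sqn (w - t%:C) by rewrite mulr_gt0.
    have := fw t; lra.
  have id : Rintegrable m (fun t => 2 / y ^+ c.+1 * (p t / sqn (w - t%:C))).
    by apply: RintegrableZ; exact: ie.
  have ic : cintegrable m (fun t => (p t)%:C / f t).
    by apply: cintegrable_dom id => //; exact: mP.
  split => //; rewrite /kernel_energy -RintegralZl//; last exact: ie.
  exact: normc_cintegral_le.
have mw (h : C) : cmeasurable (fun t : mR => w + h - t%:C) by exact: cmeasurable_line.
have mw0 : cmeasurable (fun t : mR => w - t%:C) by exact: cmeasurable_line.
have dom3 := dom (fun t => (w - t%:C) ^+ 3) 0%N.
have {dom3}[||i3 _] := dom3.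
- by rewrite /GRing.exp /=; do 2!apply: cmeasurableM => //.
- move=> t; rewrite normcX sqnE; have := Im_le_normcB w t.
  rewrite -/y => n1; have := ler_wpM2r (sqr_ge0 (normc (w - t%:C))) n1.
  have := mulr_ge0 (ltW yw) (sqr_ge0 (normc (w - t%:C))).
  by rewrite -/y !expr1 [_ ^+ 3]exprS; lra.
have dom4 h (hy : normc h < y / 2) :=
  dom (fun t => (w - t%:C) ^+ 3 * (w + h - t%:C)) 1%N.
have {}dom4 h : normc h < y / 2 ->
    cintegrable m (fun t => (p t)%:C / ((w - t%:C) ^+ 3 * (w + h - t%:C))) /\
    normc (cintegral m
      (fun t => (p t)%:C / ((w - t%:C) ^+ 3 * (w + h - t%:C))))
    <= 2 / y ^+ 2 * kernel_energy w.
  move=> hy; apply: (dom4 h hy).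
    by apply: cmeasurableM => //; rewrite /GRing.exp /=; do 2!apply: cmeasurableM => //.
  move=> t; rewrite normcM normcX sqnE.
  have n1 := Im_le_normcB w t.
  have n2 : y / 2 <= normc (w + h - t%:C).
    rewrite addrAC; have := normc_triangle_rev (w - t%:C) h.
    by move: n1 hy; rewrite -/y; lra.
  have -> : 2 * (normc (w - t%:C) ^+ 3 * normc (w + h - t%:C)) =
    (normc (w - t%:C) * (2 * normc (w + h - t%:C))) * normc (w - t%:C) ^+ 2 by ring.
  rewrite ler_wpM2r ?sqr_ge0// expr2; apply: ler_pM => //; try exact: ltW.
  by lra.
exists (- kernel_slope w w), (cintegral m (fun t => (p t)%:C / (w - t%:C) ^+ 3)),
  (fun h => - cintegral m (fun t => (p t)%:C / ((w - t%:C) ^+ 3 * (w + h - t%:C)))).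
  exists (2 / y ^+ 2 * kernel_energy w), (y / 2) => [|h /dom4[]//].
    by rewrite divr_gt0.
  by rewrite normc_opp.
exists (y / 2) => [|h hy]; first by rewrite divr_gt0.
have ywh : 0 < complex.Im (w + h).
  have := normc_Im h; rewrite cImD -/y ler_norml => /andP[h1 _].
  by move: yw; rewrite -/y => yw'; lra.
have [i4 _] := dom4 h hy.
have E := kernel_transformB ywh yw.
have -> : kernel_transform (w + h) = kernel_transform w +
   - (w + h - w) * kernel_slope (w + h) w by rewrite -E; ring.
have -> : kernel_slope (w + h) w = kernel_slope w w +
  (- h) * cintegral m (fun t => (p t)%:C / (w - t%:C) ^+ 3) +
  h ^+ 2 * cintegral m (fun t => (p t)%:C / ((w - t%:C) ^+ 3 * (w + h - t%:C))).
  have s0 := slope_integrable yw yw.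
  have s3 := cintegrableZ (- h) i3; have s4 := cintegrableZ (h ^+ 2) i4.
  rewrite /kernel_slope -(cintegralZ _ i3) -(cintegralZ _ i4).
  rewrite -(cintegralD s0 s3) -(cintegralD (cintegrableD s0 s3) s4).
  apply: eq_cintegral => t; field.
  by rewrite !subr_real_neq0.
by ring.
Qed.

End kernel_transform.

(** * The Cauchy transform of a probability measure *)

Section cauchy.
Context {R : realType}.
Local Notation C := R[i].
Local Notation mR := (measurableTypeR R).
Local Notation Rintegrable m f := (m.-integrable setT (EFin \o (f : mR -> R))).
Variable rho : probability mR R.

Lemma probability_ltey : (rho setT < +oo)%E.
Proof. by rewrite probability_setT ltry. Qed.

Lemma kernel_cauchy (z : C) (t : R) : cauchy_kernel (cst 1) (cst 0) z t = (z - t%:C)^-1.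
Proof. by rewrite /cauchy_kernel /= addr0 mul1r. Qed.

Lemma cauchy_transformE :
  cauchy_transform rho = kernel_transform rho (cst 1) (cst 0).
Proof. by apply/funext => z; apply: eq_cintegral => t; rewrite kernel_cauchy. Qed.

Lemma cauchy_kernel_integrable (z : C) : 0 < complex.Im z ->
  cintegrable rho (cauchy_kernel (cst 1) (cst 0) z).
Proof.
move=> yz; rewrite (_ : cauchy_kernel _ _ _ = fun t : mR => (z - t%:C)^-1); last first.
  by apply/funext => t; rewrite kernel_cauchy.
apply: (@cintegrable_dom _ _ _ (fun=> (complex.Im z)^-1)).
- by apply: cmeasurableV; exact: cmeasurable_line.
- move=> t; rewrite normcV lef_pV2 ?posrE ?Im_le_normcB//.
  by rewrite normc_gt0 subr_real_neq0.
- exact: Rintegrable_cst probability_ltey.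
Qed.

Lemma cauchy_energy_integrable (z : C) : 0 < complex.Im z ->
  Rintegrable rho (fun t => cst 1 t / sqn (z - t%:C)).
Proof.
move=> yz.
have sp t : 0 < sqn (z - t%:C) by rewrite sqn_gt0// subr_real_neq0.
apply: (@Rintegrable_dom _ _ _ (fun=> (complex.Im z ^+ 2)^-1)).
- apply: measurable_funM; first exact: measurable_cst.
  apply: (@measurableT_comp _ _ _ _ _ _ (fun x : R => x^-1)).
    exact: measurable_invr.
  by apply: measurable_sqn; exact: cmeasurable_line.
- move=> t; rewrite /= div1r ger0_norm ?invr_ge0 ?(ltW (sp t))//.
  rewrite lef_pV2 ?posrE ?exprn_gt0// sqnE.
  by rewrite lerXn2r ?nnegrE ?normc_ge0 ?Im_le_normcB// ltW.
- exact: Rintegrable_cst probability_ltey.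
Qed.

Lemma cauchy_energy_gt0 (z : C) : 0 < complex.Im z ->
  0 < kernel_energy rho (cst 1) z.
Proof.
move=> yz; rewrite lt_neqAle kernel_energy_ge0 ?andbT//.
have sp t : 0 < sqn (z - t%:C) by rewrite sqn_gt0// subr_real_neq0.
apply/eqP => E0.
have fi := cauchy_energy_integrable yz.
pose g : mR -> \bar R := EFin \o (fun t : mR => cst 1 t / sqn (z - t%:C)).
have mf : measurable_fun setT g by case/integrableP: fi.
have := (ae_eq_integral_abs rho measurableT mf).1.
have -> : (\int[rho]_x `|g x| = 0)%E.
  rewrite (eq_integral g) => [|t _]; last first.
    by rewrite gee0_abs// lee_fin divr_ge0// ltW.
  rewrite -[LHS]fineK; last exact: integrable_fin_num.
  by rewrite -[fine _]/(kernel_energy rho (cst 1) z) -E0.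
(* the energy density vanishes nowhere, so the exceptional set is the line *)
move=> /(_ erefl) [N [mN N0 sub]].
have : rho setT = 0%E.
  apply/eqP; rewrite eq_le measure_ge0 andbT -N0; apply: le_measure; rewrite ?inE//.
  move=> t _; apply: sub => /= /(_ Logic.I) /eqP.
  by rewrite /= eqe div1r invr_eq0 gt_eqF.
by rewrite probability_setT => /eqP; rewrite onee_eq0.
Qed.

Lemma jet2_cauchy (z : C) : 0 < complex.Im z -> jet2 (cauchy_transform rho) z.
Proof.
move=> yz; rewrite cauchy_transformE; apply: jet2_kernel_transform => //.
- exact: cauchy_kernel_integrable.
- exact: cauchy_energy_integrable.
Qed.

Lemma Im_cauchy_lt0 (z : C) : 0 < complex.Im z ->
  complex.Im (cauchy_transform rho z) < 0.
Proof.
move=> yz; rewrite cauchy_transformE Im_kernel_transform//.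
- by rewrite mulNr oppr_lt0 mulr_gt0// cauchy_energy_gt0.
- exact: cauchy_energy_integrable.
Qed.

Lemma cauchy_neq0 (z : C) : 0 < complex.Im z -> cauchy_transform rho z != 0.
Proof.
by move=> /Im_cauchy_lt0; apply: contraTneq => ->; rewrite ltxx.
Qed.

Lemma Im_reciprocal_gt0 (z : C) : 0 < complex.Im z ->
  0 < complex.Im (reciprocal_cauchy_transform rho z).
Proof.
move=> yz; rewrite cImV divr_gt0 ?sqn_gt0 ?cauchy_neq0//.
by rewrite oppr_gt0 Im_cauchy_lt0.
Qed.

End cauchy.

(** * The right inverse given by a Levy measure *)

Section levy.
Context {R : realType}.
Local Notation C := R[i].
Local Notation mR := (measurableTypeR R).
Local Notation Rintegrable m f := (m.-integrable setT (EFin \o (f : mR -> R))).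
Variables (eta a : R) (nu : {measure set mR -> \bar R}).
Hypotheses (a0 : 0 <= a) (lnu : levy_measure nu).

Definition levy_weight (t : mR) : R := t ^+ 2.
(** With this drift, [w * ((1 - t / w)^-1 - 1 - t / w * \1_(`[-1, 1]) t)] is
    equal to [t ^+ 2 / (w - t) + levy_drift t]. *)
Definition levy_drift (t : mR) : R := t * (1 - \1_(`[-1, 1]) t).
Local Notation p := levy_weight.
Local Notation q := levy_drift.

Lemma min_sqr_integrable : Rintegrable nu (fun t : mR => Num.min 1 (t ^+ 2)).
Proof.
case: lnu => _ fin; apply/integrableP; split.
  apply/measurable_EFinP; apply: measurable_minr; first exact: measurable_cst.
  by apply: measurable_funX; exact: measurable_id.
rewrite (eq_integral (fun t : mR => (Num.min 1 ((t : R) ^+ 2))%:E))// => t _.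
by rewrite gee0_abs// lee_fin le_min ler01 sqr_ge0.
Qed.

Lemma measurable_levy_weight : measurable_fun setT p.
Proof. by apply: measurable_funX; exact: measurable_id. Qed.

Lemma measurable_levy_drift : measurable_fun setT q.
Proof.
apply: measurable_funM; first exact: measurable_id.
apply: measurable_funB; first exact: measurable_cst.
by apply: measurable_indic; exact: measurable_itv.
Qed.

Lemma levy_weight_ge0 t : 0 <= p t. Proof. exact: sqr_ge0. Qed.

Lemma resolvent_ratio_le (w : C) (t : R) : 0 < complex.Im w ->
  normc (t%:C / (w - t%:C)) <= 1 + normc w / complex.Im w.
Proof.
move=> yw.
have -> : t%:C / (w - t%:C) = w / (w - t%:C) - 1.
  by field; rewrite subr_real_neq0.
rewrite (le_trans (normcB_le _ _))// normc1 addrC lerD2l normcM normcV.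
rewrite ler_wpM2l ?normc_ge0// lef_pV2 ?posrE ?Im_le_normcB//.
by rewrite normc_gt0 subr_real_neq0.
Qed.

Lemma resolvent_le_invIm (w : C) (t : R) : 0 < complex.Im w ->
  normc (w - t%:C)^-1 <= (complex.Im w)^-1.
Proof.
move=> yw; rewrite normcV lef_pV2 ?posrE ?Im_le_normcB//.
by rewrite normc_gt0 subr_real_neq0.
Qed.

Lemma levy_energy_integrable (w : C) : 0 < complex.Im w ->
  Rintegrable nu (fun t => p t / sqn (w - t%:C)).
Proof.
move=> yw.
(* two bounds, by t^2 / (Im w)^2 near the origin and by a constant elsewhere *)
pose K := (1 + normc w / complex.Im w) ^+ 2 + (complex.Im w)^-1 ^+ 2.
have E t : p t / sqn (w - t%:C) = normc (t%:C / (w - t%:C)) ^+ 2.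
  rewrite normcM normcV normc_real exprMn real_normK ?num_real//.
  by rewrite sqnE exprVn.
apply: (@Rintegrable_dom _ _ _ (fun t => K * Num.min 1 (t ^+ 2))).
- apply: measurable_funM; first exact: measurable_levy_weight.
  apply: (@measurableT_comp _ _ _ _ _ _ (fun x : R => x^-1)).
    exact: measurable_invr.
  by apply: measurable_sqn; exact: cmeasurable_line.
- move=> t; rewrite E ger0_norm ?sqr_ge0//.
  have r1 := resolvent_ratio_le t yw; have r2 := resolvent_le_invIm t yw.
  have k1 : 0 <= (1 + normc w / complex.Im w) ^+ 2 by exact: sqr_ge0.
  have k2 : 0 <= (complex.Im w)^-1 ^+ 2 by exact: sqr_ge0.
  rewrite minEle; case: ifP => _.
    rewrite mulr1 (@le_trans _ _ ((1 + normc w / complex.Im w) ^+ 2)) ?lerDl//.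
    by rewrite lerXn2r ?nnegrE ?normc_ge0// (le_trans (normc_ge0 _) r1).
  rewrite normcM normc_real exprMn real_normK ?num_real// mulrC.
  rewrite ler_wpM2r ?sqr_ge0// (@le_trans _ _ ((complex.Im w)^-1 ^+ 2)) ?lerDr//.
  by rewrite lerXn2r ?nnegrE ?normc_ge0// (le_trans (normc_ge0 _) r2).
- by apply: RintegrableZ; exact: min_sqr_integrable.
Qed.

Lemma indic_unit_itv (t : R) : \1_(`[-1, 1]) t = (`|t| <= 1)%R%:R :> R.
Proof.
rewrite indicE; congr (_%:R); congr nat_of_bool.
apply/idP/idP => [|h]; rewrite ?inE /= ?in_itv/= -ler_norml//.
Qed.

Lemma levy_kernel_integrable (w : C) : 0 < complex.Im w ->
  cintegrable nu (cauchy_kernel p q w).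
Proof.
move=> yw; pose K := normc w * (1 + normc w / complex.Im w) + (complex.Im w)^-1.
apply: (@cintegrable_dom _ _ _ (fun t => K * Num.min 1 (t ^+ 2))).
- apply: cmeasurableD; last exact: cmeasurable_real measurable_levy_drift.
  apply: cmeasurableM; first exact: cmeasurable_real measurable_levy_weight.
  by apply: cmeasurableV; exact: cmeasurable_line.
- move=> t; have r1 := resolvent_ratio_le t yw; have r2 := resolvent_le_invIm t yw.
  have k1 : 0 <= normc w * (1 + normc w / complex.Im w).
    by rewrite mulr_ge0 ?normc_ge0// addr_ge0// divr_ge0 ?normc_ge0// ltW.
  have k2 : 0 <= (complex.Im w)^-1 by rewrite invr_ge0 ltW.
  rewrite /cauchy_kernel /p /q indic_unit_itv; case: (leP `|t| 1) => t1.
    rewrite mulr1n subrr mulr0 addr0 normcM normc_real ger0_norm ?sqr_ge0// mulrC.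
    have t2 : t ^+ 2 <= 1 by rewrite -real_normK ?num_real// expr_le1.
    have -> : Num.min 1 (t ^+ 2) = t ^+ 2 by apply/min_idPr.
    by rewrite ler_wpM2r ?sqr_ge0// (le_trans r2)// lerDr.
  rewrite mulr0n subr0 mulr1.
  have t2 : 1 <= t ^+ 2 by rewrite -real_normK ?num_real// expr_ge1// ltW.
  have -> : Num.min 1 (t ^+ 2) = 1 by apply/min_idPl.
  have -> : (t ^+ 2)%:C / (w - t%:C) + t%:C = w * (t%:C / (w - t%:C)).
    by rewrite rmorphXn /=; field; rewrite subr_real_neq0.
  by rewrite normcM mulr1 (le_trans (ler_wpM2l (normc_ge0 _) r1))// lerDl.
- by apply: RintegrableZ; exact: min_sqr_integrable.
Qed.

Local Notation H := (extended_right_inverse eta a nu).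

Lemma Im_neq0 (w : C) : 0 < complex.Im w -> w != 0.
Proof. by apply: contraTneq => ->; rewrite ltxx. Qed.

(** The compensated integral becomes a [kernel_transform], whose dependence on
    [w] is explicit. *)
Lemma right_inverseE (w : C) : 0 < complex.Im w ->
  H w = w + eta%:C + a%:C / w + kernel_transform nu p q w.
Proof.
move=> yw; have w0 := Im_neq0 yw.
rewrite /extended_right_inverse /free_levy_khintchine.
have -> : cintegral nu (fun t : mR => (1 - t%:C * w^-1)^-1 - 1 -
    t%:C * w^-1 * (\1_(`[-1, 1]) t)%:C) = w^-1 * kernel_transform nu p q w.
  rewrite /kernel_transform -cintegralZ; last exact: levy_kernel_integrable.
  apply: eq_cintegral => t; rewrite /cauchy_kernel /p /q.
  set i := \1_(`[-1, 1]) t.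
  have -> : (t ^+ 2)%:C = t%:C ^+ 2 by rewrite rmorphXn.
  have -> : (t * (1 - i))%:C = t%:C * (1 - i%:C).
    by apply: complexP => /=; ring.
  by field; rewrite w0 subr_real_neq0.
by field.
Qed.

Lemma jet2_right_inverse (w : C) : 0 < complex.Im w -> jet2 H w.
Proof.
move=> yw; apply: (@jet2_near _
  (fun w => w + eta%:C + a%:C / w + kernel_transform nu p q w)).
  exists (complex.Im w) => // h hw; rewrite right_inverseE//.
  by have := normc_Im h; rewrite cImD ler_norml => /andP[h1 _]; lra.
apply: jet2D.
  apply: jet2D; first by apply: jet2D; [exact: jet2_id|exact: jet2_cst].
  by apply: jet2M; [exact: jet2_cst|apply: jet2_inv; exact: Im_neq0].
apply: jet2_kernel_transform => //.
- exact: measurable_levy_weight.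
- exact: levy_weight_ge0.
- exact: levy_kernel_integrable.
- exact: levy_energy_integrable.
Qed.

(** The share of [Im w] that is lost by [H w]; see [Im_right_inverse]. *)
Definition energy (w : C) : R := a / sqn w + kernel_energy nu p w.

Lemma Im_right_inverse (w : C) : 0 < complex.Im w ->
  complex.Im (H w) = complex.Im w * (1 - energy w).
Proof.
move=> yw; rewrite right_inverseE// !cImD Im_kernel_transform//; last first.
  exact: levy_energy_integrable.
by rewrite cImM cImV /energy /=; ring.
Qed.

Lemma energy_lt1 (w : C) : 0 < complex.Im w -> 0 < complex.Im (H w) ->
  energy w < 1.
Proof. by move=> yw; rewrite Im_right_inverse// pmulr_rgt0// subr_gt0. Qed.

(** The divided difference of [H] is [1 - S] with [|S| <= (energy w1 + energy
    w2) / 2]. *)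
Lemma right_inverse_dist (w1 w2 : C) : 0 < complex.Im w1 -> 0 < complex.Im w2 ->
  normc (w1 - w2) * (1 - (energy w1 + energy w2) / 2) <= normc (H w1 - H w2).
Proof.
move=> y1 y2; have w10 := Im_neq0 y1; have w20 := Im_neq0 y2.
pose S := a%:C / (w1 * w2) + kernel_slope nu p w1 w2.
have -> : H w1 - H w2 = (w1 - w2) * (1 - S).
  rewrite !right_inverseE//.
  have := @kernel_transformB _ nu p q measurable_levy_weight levy_weight_ge0
    levy_kernel_integrable levy_energy_integrable _ _ y1 y2.
  move/eqP; rewrite subr_eq => /eqP ->.
  by rewrite /S; field; rewrite w10 w20.
rewrite normcM ler_wpM2l ?normc_ge0//.
have : normc S <= (energy w1 + energy w2) / 2.
  rewrite (le_trans (normcD_le _ _))//.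
  have := @kernel_slope_le _ nu p measurable_levy_weight levy_weight_ge0
    levy_energy_integrable _ _ y1 y2.
  have : normc (a%:C / (w1 * w2)) <= (a / sqn w1 + a / sqn w2) / 2.
    rewrite normcM normc_real ger0_norm// -mulrDr -mulrA ler_wpM2l//.
    rewrite normcV normcM invfM !sqnE -!exprVn.
    set b := (normc w1)^-1; set c := (normc w2)^-1.
    by have := sqr_ge0 (b - c); rewrite sqrrB; lra.
  by rewrite /energy; lra.
have := normc_triangle_rev 1 (- S); rewrite normc1 normc_opp; lra.
Qed.

(** No two points of [{Im H > 0}] share a value, although [H] need not be
    injective on the upper half-plane. *)
Lemma right_inverse_inj (w1 w2 : C) : 0 < complex.Im w1 -> 0 < complex.Im w2 ->
  0 < complex.Im (H w1) -> H w1 = H w2 -> w1 = w2.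
Proof.
move=> y1 y2 h1 E; have e1 := energy_lt1 y1 h1.
have e2 : energy w2 < 1 by apply: energy_lt1 => //; rewrite -E.
have := right_inverse_dist y1 y2; rewrite E subrr normc0 => h.
apply/eqP; rewrite -subr_eq0; apply/negPn/negP; rewrite -normc_gt0 => n0.
by have := mulr_gt0 n0 (_ : 0 < 1 - (energy w1 + energy w2) / 2); lra.
Qed.

End levy.

(** * The reciprocal Cauchy transform and the right inverse are inverse to each other *)

Section inversion.
Context {R : realType}.
Local Notation C := R[i].
Local Notation mR := (measurableTypeR R).
Variables (rho : probability mR R) (eta a : R).
Variable (nu : {measure set mR -> \bar R}).
Hypothesis triplet : free_characteristic_triplet rho eta a nu.
Local Notation H := (extended_right_inverse eta a nu).
Local Notation F := (reciprocal_cauchy_transform rho).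

Lemma triplet_ge0 : 0 <= a. Proof. by case: triplet. Qed.
Lemma triplet_levy : levy_measure nu. Proof. by case: triplet. Qed.

Lemma jet2_reciprocal (z : C) : 0 < complex.Im z -> jet2 F z.
Proof. by move=> yz; apply: jet2V; [exact: cauchy_neq0|exact: jet2_cauchy]. Qed.

(** The only use of the hypothesis on free cumulants: on a small disc, [F]
    inverts [H] on the left. *)
Lemma cone_inverse : exists2 w0 : C, 0 < complex.Im w0 &
  near0 (fun h => [/\ 0 < complex.Im (w0 + h), 0 < complex.Im (H (w0 + h)) &
                  F (H (w0 + h)) = w0 + h]).
Proof.
case: triplet => _ _ [l [M [l0 M0 [g [al [be [al0 be0 _ gE]]] KE]]]].
(* a point at height M + 1 on the imaginary axis is interior to the cone *)
exists (0 +i* (M + 1)) => /=; first by rewrite addr_gt0.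
have d0 : 0 < Num.min (2^-1) (l * M) by rewrite lt_min invr_gt0 ltr0n mulr_gt0.
exists (Num.min (2^-1) (l * M)) => // h.
rewrite lt_min => /andP[h1 h2].
set w := _ + h.
have hR := normc_Re h; have hI := normc_Im h.
have wM : M < complex.Im w.
  rewrite /w cImD /=; move: hI; rewrite ler_norml => /andP[]; lra.
have cw : truncated_cone l M w.
  split=> //; rewrite /w cReD add0r (le_lt_trans hR)// (lt_trans h2)//.
  by rewrite ltr_pM2l.
have yw : 0 < complex.Im w by rewrite (lt_trans M0).
have Hw : H w = g w.
  rewrite /extended_right_inverse (KE w^-1) invrK//.
  by field; exact: Im_neq0.
have [[gw _] Fw] := gE _ cw.
by split; rewrite ?Hw// (lt_trans be0).
Qed.

(** On the disc of [cone_inverse] the image of [H] contains a neighbourhood of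
    [H w0] by the open mapping lemma, whose boundary estimate comes from
    [right_inverse_dist]. *)
Lemma right_inverse_reciprocal_near : exists2 z0 : C, 0 < complex.Im z0 &
  near0 (fun h => H (F (z0 + h)) = z0 + h).
Proof.
have [w0 y0 [d d0 inv]] := cone_inverse.
have a0 := triplet_ge0; have lnu := triplet_levy.
have [|_ Hy0 _] := inv 0; first by rewrite normc0.
rewrite addr0 in Hy0.
exists (H w0) => //.
pose r := d / 2; have r0 : 0 < r by rewrite divr_gt0.
have invw w : normc (w - w0) <= r ->
    [/\ 0 < complex.Im w, 0 < complex.Im (H w) & F (H w) = w].
  move=> wr; rewrite -(subrKC w0 w); apply: inv.
  by rewrite (le_lt_trans wr)// /r; lra.
have e0 := energy_lt1 lnu y0 Hy0.
pose c := r * ((1 - energy a nu w0) / 2).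
have c0 : 0 < c by rewrite mulr_gt0// divr_gt0// subr_gt0.
have jH w : normc (w - w0) <= r -> jet2 H w.
  by move=> /invw[yw _ _]; exact: jet2_right_inverse.
have bH w : normc (w - w0) = r -> c <= normc (H w - H w0).
  move=> wr; have wr' : normc (w - w0) <= r by rewrite wr.
  have [yw Hyw _] := invw w wr'.
  have := @right_inverse_dist _ eta a nu a0 lnu w w0 yw y0.
  apply: le_trans; rewrite wr ler_pM2l//; have := energy_lt1 lnu yw Hyw; lra.
apply: near0_imp (open_mapping r0 c0 jH bH) => h [w /invw[_ _ Fw] <-].
by rewrite Fw.
Qed.

(** Analytic continuation of [H (F z) = z] from a disc to the half-plane. This
    direction continues everywhere, since [F] preserves the upper half-plane,
    which [H] need not do. *)
Lemma reciprocalK (z : C) : 0 < complex.Im z -> H (F z) = z.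
Proof.
move=> yz; have [z0 y0 near] := right_inverse_reciprocal_near.
apply/eqP; rewrite -subr_eq0; apply/eqP.
apply: (@identity_theorem _ (fun z => H (F z) - z) z0) => // [w yw|].
  apply: jet2B; last exact: jet2_id.
  apply: jet2_comp; last exact: jet2_reciprocal.
  by apply: jet2_right_inverse (Im_reciprocal_gt0 _ yw); exact: triplet_levy.
by apply: near0_imp near => h ->; rewrite subrr.
Qed.

(** [F (H w)] and [w] have the same image under [H], by [reciprocalK]. *)
Lemma right_inverseK (w : C) : 0 < complex.Im w -> 0 < complex.Im (H w) ->
  F (H w) = w.
Proof.
move=> yw yH; have yF := Im_reciprocal_gt0 rho yH.
apply: (@right_inverse_inj _ eta a nu triplet_ge0 triplet_levy _ _ yF yw).
  by rewrite reciprocalK.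
by rewrite reciprocalK.
Qed.

End inversion.

(** * Atoms as nontangential limits *)

Section atoms.
Context {R : realType}.
Local Notation C := R[i].
Local Notation mR := (measurableTypeR R).
Local Notation Rintegrable m f := (m.-integrable setT (EFin \o (f : mR -> R))).

(** [K] bounds the aperture of the cone in which [z] approaches [x]. *)
Definition nontangential (z : nat -> C) (x K : R) :=
  [/\ forall n, 0 < complex.Im (z n),
      forall n, normc (z n - x%:C) <= K * complex.Im (z n) &
      (fun n => normc (z n - x%:C)) @ \oo --> (0 : R)].

Lemma ge0_le_cvg0 (c : R) (u : nat -> R) :
  (forall n, c <= u n) -> u @ \oo --> (0 : R) -> c <= 0.
Proof.
move=> cu u0; rewrite -(cvg_lim (@Rhausdorff R) u0); apply: limr_ge.
  by apply/cvg_ex; eexists; exact: u0.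
by near=> n; exact: cu.
Unshelve. all: by end_near. Qed.

Lemma cvg0_le (u v : nat -> R) : (forall n, 0 <= u n <= v n) ->
  v @ \oo --> (0 : R) -> u @ \oo --> (0 : R).
Proof.
move=> uv v0; apply: (@squeeze_cvgr _ _ _ _ (fun=> 0) v) => //.
  by near=> n; exact: uv.
exact: cvg_cst.
Unshelve. all: by end_near. Qed.

Lemma indic_set1 (x t : R) : \1_([set x]) t = (t == x)%:R :> R.
Proof.
rewrite indicE; congr (nat_of_bool _)%:R.
by apply/idP/eqP => [/set_mem//|->]; exact/mem_set.
Qed.

Lemma indic_setC1 (x t : R) : \1_(~` [set x]) t = (t != x)%:R :> R.
Proof.
rewrite indicE; congr (nat_of_bool _)%:R.
apply/idP/idP => [/set_mem /= /eqP//|/eqP tx]; exact/mem_set.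
Qed.

Variables (m : {measure set mR -> \bar R}).
Hypothesis mfin : (m setT < +oo)%E.

Lemma resolvent_integrable (z : C) : 0 < complex.Im z ->
  cintegrable m (fun t => (z - t%:C)^-1).
Proof.
move=> yz; apply: (@cintegrable_dom _ _ _ (fun=> (complex.Im z)^-1)).
- by apply: cmeasurableV; exact: cmeasurable_line.
- by move=> t; exact: resolvent_le_invIm.
- exact: Rintegrable_cst.
Qed.

Lemma normc_resolvent_le (z : C) (x K t : R) : 0 < complex.Im z ->
  normc (z - x%:C) <= K * complex.Im z ->
  normc ((z - x%:C) / (z - t%:C)) <= K.
Proof.
move=> yz zK; rewrite normcM.
rewrite (le_trans (ler_wpM2l (normc_ge0 _) (resolvent_le_invIm t yz)))//.
by rewrite ler_pdivrMr.
Qed.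

(** Dominated convergence: off [x] the integrand tends to 0, and it is bounded
    by [K] because the approach is nontangential. *)
Lemma resolvent_vanish (z : nat -> C) (x K : R) : nontangential z x K ->
  (fun n => Rintegral m setT (fun t : mR =>
    normc ((z n - x%:C) / (z n - t%:C)) * \1_(~` [set x]) t)) @ \oo --> (0 : R).
Proof.
move=> [yz zK zx].
pose f n (t : mR) : \bar R :=
  (normc ((z n - x%:C) / (z n - t%:C)) * \1_(~` [set x]) t)%:E.
have K0 : 0 <= K.
  by rewrite -(pmulr_lge0 _ (yz 0%N)) (le_trans (normc_ge0 _) (zK 0%N)).
have [] := @dominated_convergence _ mR R m setT measurableT f (cst 0%E) (cst K%:E).
- move=> n; apply/measurable_EFinP; apply: measurable_funM.
    apply: measurable_normc; apply: cmeasurableM; first exact: cmeasurable_cst.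
    by apply: cmeasurableV; exact: cmeasurable_line.
  by apply: measurable_indic; apply: measurableC; exact: measurable_set1.
- exact: measurable_cst.
- apply/aeW => t _; rewrite /f indic_setC1; have [tx|tx] := eqVneq t x.
    by under eq_fun do rewrite mulr0; exact: cvg_cst.
  apply/cvg_EFin; first by near=> n.
  have tx0 : 0 < `|x - t| / 2 by rewrite divr_gt0// normr_gt0 subr_eq0 eq_sym.
  apply: (@squeeze_cvgr _ _ _ _ (fun=> 0)
     (fun n => normc (z n - x%:C) * (2 / `|x - t|))).
  + near=> n; rewrite /= mulr1 normc_ge0/= normcM ler_wpM2l ?normc_ge0//.
    have zn : normc (z n - x%:C) < `|x - t| / 2.
      by near: n; move/cvgr_lt : zx; apply.
    rewrite normcV -[2 / _]invf_div lef_pV2 ?posrE//; last first.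
      by rewrite normc_gt0 subr_real_neq0.
    have := normc_triangle_rev (x - t)%:C (z n - x%:C); rewrite normc_real.
    rewrite (_ : (x - t)%:C + _ = z n - t%:C).
      by move: zn; rewrite -/(normc _); lra.
    by rewrite rmorphB /=; ring.
  + exact: cvg_cst.
  + rewrite -(mul0r (2 / `|x - t|)); apply: cvgM => //; exact: cvg_cst.
- exact: Rintegrable_cst.
- apply/aeW => t n _; rewrite /f gee0_abs ?lee_fin ?mulr_ge0 ?normc_ge0//.
  rewrite indicE (le_trans (ler_piMr _ _)) ?normc_ge0 ?lern1 ?leq_b1//.
  exact: normc_resolvent_le.
move=> _ _; rewrite integral0 => h.
exact: (fine_cvg h).
Unshelve. all: by end_near. Qed.

(** The mass of a point is the nontangential limit of [z - x] times the Cauchy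
    transform; applied both to the law and to its free Levy measure. *)
Lemma atom_limit (z : nat -> C) (x K : R) : nontangential z x K ->
  (fun n => normc ((z n - x%:C) * cintegral m (fun t => (z n - t%:C)^-1) -
                   (fine (m [set x]))%:C)) @ \oo --> (0 : R).
Proof.
move=> zn; have [yz zK zx] := zn.
apply: cvg0_le (resolvent_vanish zn) => n; rewrite normc_ge0 /=.
have i1 := cintegrableZ (z n - x%:C) (resolvent_integrable (yz n)).
have mx : measurable_fun setT (\1_([set x]) : mR -> R).
  by apply: measurable_indic; exact: measurable_set1.
have i2 : cintegrable m (fun t : mR => (\1_([set x]) t : R)%:C).
  apply: (@cintegrable_dom _ _ _ (fun=> 1)); last exact: Rintegrable_cst.
    exact: cmeasurable_real.
  by move=> t; rewrite normc_real ger0_norm// indicE lern1 leq_b1.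
have -> : (fine (m [set x]))%:C = cintegral m (fun t : mR => (\1_([set x]) t : R)%:C).
  apply: complexP => /=; last by rewrite Rintegral_cst ?mul0r.
  by rewrite /Rintegral integral_indic ?setIT.
rewrite -(cintegralZ _ (resolvent_integrable (yz n))) -[- cintegral _ _]mulN1r.
rewrite -(cintegralZ _ i2).
rewrite -(cintegralD i1 (cintegrableZ (-1) i2)).
apply: normc_cintegral_le => [||t].
- exact: cintegrableD i1 (cintegrableZ (-1) i2).
- apply: (@Rintegrable_dom _ _ _ (fun=> K)); last exact: Rintegrable_cst.
    apply: measurable_funM; last first.
      by apply: measurable_indic; apply: measurableC; exact: measurable_set1.
    apply: measurable_normc; apply: cmeasurableM; first exact: cmeasurable_cst.
    by apply: cmeasurableV; exact: cmeasurable_line.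
  move=> t; rewrite ger0_norm ?mulr_ge0 ?normc_ge0//.
  rewrite indicE (le_trans (ler_piMr _ _)) ?normc_ge0 ?lern1 ?leq_b1//.
  exact: normc_resolvent_le.
- rewrite indic_set1 indic_setC1; have [->|tx] := eqVneq t x.
    by rewrite mulfV ?subr_real_neq0// mulN1r subrr normc0 mulr_ge0 ?normc_ge0.
  by rewrite mulr0 addr0 mulr1.
Qed.

End atoms.

(** * The right inverse near the origin in the type A case *)

Section type_A.
Context {R : realType}.
Local Notation C := R[i].
Local Notation mR := (measurableTypeR R).
Local Notation Rintegrable m f := (m.-integrable setT (EFin \o (f : mR -> R))).
Variables (eta : R) (nu : {measure set mR -> \bar R}).
Hypotheses (lnu : levy_measure nu) (nufin : (nu setT < +oo)%E).
Local Notation H := (extended_right_inverse eta 0 nu).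

(** The value of the right inverse at [+i0] in the type A case. *)
Definition free_drift : R :=
  eta - Rintegral nu setT (fun t : mR => t * \1_(`[-1, 1]) t).

Local Notation V := (fine (nu setT)).

(** When [nu] is finite, [t ^+ 2 / (w - t) + t] is [w * (w / (w - t) - 1)] and
    each term can be integrated separately: the correction to the slope [1 -
    nu(R)] is [w] times the Cauchy transform of [nu], whose nontangential limit
    at 0 is the mass of [nu] at 0, that is 0. *)
Lemma type_A_expansion (w : C) : 0 < complex.Im w ->
  H w = free_drift%:C +
    w * ((1 - V)%:C + w * cintegral nu (fun t => (w - t%:C)^-1)).
Proof.
move=> yw; rewrite right_inverseE// mul0r addr0.
have ires := resolvent_integrable nufin yw.
have i0 := cintegrableZ w (cintegrableZ w ires).
have i1 : cintegrable nu (fun=> 1).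
  apply: (@cintegrable_dom _ _ _ (fun=> 1)); last exact: Rintegrable_cst.
    exact: cmeasurable_cst.
  by move=> t; rewrite normc1.
have i2 : cintegrable nu (fun t : mR => (t * \1_(`[-1, 1]) t)%:C).
  apply: (@cintegrable_dom _ _ _ (fun=> 1)); last exact: Rintegrable_cst.
    apply: cmeasurable_real; apply: measurable_funM; first exact: measurable_id.
    by apply: measurable_indic; exact: measurable_itv.
  move=> t; rewrite normc_real indic_unit_itv normrM.
  by case: (leP `|t| 1) => t1; rewrite ?normr1 ?normr0 ?mulr1 ?mulr0.
have -> : kernel_transform nu levy_weight levy_drift w =
    w * (w * cintegral nu (fun t => (w - t%:C)^-1)) + (- w) * V%:C +
    (-1) * (Rintegral nu setT (fun t : mR => t * \1_(`[-1, 1]) t))%:C.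
  have -> : V%:C = cintegral nu (fun=> 1).
    by apply: complexP => /=; rewrite Rintegral_cst ?mul1r ?mul0r.
  have -> : (Rintegral nu setT (fun t : mR => t * \1_(`[-1, 1]) t))%:C =
      cintegral nu (fun t : mR => (t * \1_(`[-1, 1]) t)%:C).
    by apply: complexP => //=; rewrite Rintegral_cst ?mul0r.
  rewrite -(cintegralZ w ires) -(cintegralZ w (cintegrableZ w ires)).
  rewrite -(cintegralZ _ i1) -(cintegralZ _ i2).
  rewrite -(cintegralD i0 (cintegrableZ (- w) i1)).
  rewrite -(cintegralD (cintegrableD i0 (cintegrableZ (- w) i1))
    (cintegrableZ (-1) i2)).
  apply: eq_cintegral => t; rewrite /cauchy_kernel /levy_weight /levy_drift.
  set i := \1_(`[-1, 1]) t.
  have -> : (t ^+ 2)%:C = t%:C ^+ 2 by rewrite rmorphXn.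
  have -> : (t * (1 - i))%:C = t%:C * (1 - i%:C).
    by apply: complexP => /=; ring.
  have -> : (t * i)%:C = t%:C * i%:C by apply: complexP => /=; ring.
  by field; rewrite subr_real_neq0.
rewrite /free_drift; set I := Rintegral _ _ _.
have -> : (eta - I)%:C = eta%:C - I%:C by apply: complexP => /=; ring.
have -> : (1 - V)%:C = 1 - V%:C by apply: complexP => /=; ring.
by ring.
Qed.

Lemma moment_resolvent_le (w : C) : 0 < complex.Im w ->
  normc (w * cintegral nu (fun t => (w - t%:C)^-1)) <=
  normc w / complex.Im w * V.
Proof.
move=> yw; have ires := resolvent_integrable nufin yw.
rewrite -(cintegralZ w ires) -Rintegral_cst//.
apply: normc_cintegral_le => [||t].
- exact: cintegrableZ.
- exact: Rintegrable_cst.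
- by rewrite normcM ler_wpM2l ?normc_ge0// resolvent_le_invIm.
Qed.

Lemma normc_imaginary (y : R) : 0 < y -> normc (0 +i* y) = y.
Proof. by move=> y0; rewrite /= expr0n /= add0r sqrtr_sqr gtr0_norm. Qed.

Lemma fine_mass_ge0 : 0 <= V. Proof. by rewrite fine_ge0// measure_ge0. Qed.

Lemma right_inverse_drift_le (y : R) : 0 < y ->
  normc (H (0 +i* y) - free_drift%:C) <= y * (1 + 2 * V).
Proof.
move=> y0; rewrite type_A_expansion// addrAC subrr add0r normcM normc_imaginary//.
rewrite ler_pM2l// (le_trans (normcD_le _ _))//.
have := moment_resolvent_le (w := 0 +i* y) y0.
rewrite normc_imaginary// [complex.Im _]/= divff ?gt_eqF// mul1r.
have : normc (1 - V)%:C <= 1 + V.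
  by rewrite normc_real (le_trans (ler_normB _ _))// normr1 ger0_norm ?fine_mass_ge0.
by lra.
Qed.

Lemma right_inverse_drift_cvg :
  (fun y : R => H (0 +i* y) : R[i]^o) @ 0^'+ --> (free_drift%:C : R[i]^o).
Proof.
apply/cvgrPdist_le => e e0.
have [r r0 re] : exists2 r : R, 0 < r & e = r%:C.
  by case: e e0 => x y; rewrite ltcE /= => /andP[/eqP -> x0]; exists x.
have V0 := fine_mass_ge0.
have k0 : 0 < 1 + 2 * V by lra.
near=> y.
have y0 : 0 < y by near: y; exact: nbhs_right_gt.
have : normc (H (0 +i* y) - free_drift%:C) <= r.
  rewrite (le_trans (right_inverse_drift_le y0))// -ler_pdivlMr//.
  by near: y; apply: nbhs_right_le; rewrite divr_gt0.
rewrite re distrC normc_def -lecR => /le_trans; apply; rewrite lecR.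
by case: (H _ - _).
Unshelve. all: by end_near. Qed.

End type_A.

(** * Finiteness of the Levy measure *)

Section finite_levy_measure.
Context {R : realType}.
Local Notation C := R[i].
Local Notation mR := (measurableTypeR R).
Variables (rho : probability mR R) (eta a : R).
Variable (nu : {measure set mR -> \bar R}).
Hypothesis triplet : free_characteristic_triplet rho eta a nu.
Local Notation H := (extended_right_inverse eta a nu).
Local Notation F := (reciprocal_cauchy_transform rho).
Local Notation G := (cauchy_transform rho).

Lemma nontangential_vertical (x : R) :
  nontangential (fun n => x +i* harmonic n) x 1.
Proof.
have E n : normc (x +i* harmonic n - x%:C) = harmonic n :> R.
  rewrite (_ : _ - _ = 0 +i* harmonic n) ?normc_imaginary ?harmonic_gt0//.
  by apply: complexP => /=; ring.
split=> [n|n|]; first exact: harmonic_gt0.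
  by rewrite E mul1r.
by under eq_fun do rewrite E; exact: cvg_harmonic.
Qed.

(** [Im (H (w n)) > 0] says that the energy at [w n] is less than 1. As [w n]
    tends to 0, the term [a / |w n|^2] forces [a = 0], and the integrals of [t^2
    / |w n - t|^2], bounded by 1, force [nu] to be finite. *)
Lemma nontangential_type_A (w : nat -> C) (K : R) : nontangential w 0 K ->
  (forall n, 0 < complex.Im (H (w n))) -> a = 0 /\ (nu setT < +oo)%E.
Proof.
move=> [yw wK w0] yH.
have lnu := triplet_levy triplet; have a0 := triplet_ge0 triplet.
have A1 n : energy a nu (w n) < 1 := energy_lt1 lnu (yw n) (yH n).
have nw n : 0 < normc (w n) by rewrite normc_gt0 Im_neq0.
have W0 : (fun n => normc (w n)) @ \oo --> (0 : R).
  by move: w0; under eq_fun do rewrite subr0.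
have p0 := @levy_weight_ge0 R.
split.
  apply/eqP; rewrite eq_le a0 andbT.
  apply: (@ge0_le_cvg0 _ _ (fun n => normc (w n) ^+ 2)).
    move=> n; rewrite -sqnE -[leRHS]mul1r -ler_pdivrMr ?sqn_gt0 -?normc_gt0//.
    have := A1 n; rewrite /energy; have := kernel_energy_ge0 nu p0 (w n); lra.
  rewrite (_ : (fun n => _ ^+ 2) = (fun n => normc (w n) * normc (w n))).
    have h : (fun n => normc (w n) * normc (w n)) @ \oo --> (0 * 0 : R).
      by apply: cvgM.
    by rewrite mulr0 in h.
  by apply/funext => n; rewrite expr2.
pose f n (t : mR) : \bar R := (levy_weight t / sqn (w n - t%:C))%:E.
have mf n : measurable_fun setT (f n).
  by have /integrableP[] := levy_energy_integrable lnu (yw n).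
have f0 n t : (0 <= f n t)%E.
  by rewrite lee_fin divr_ge0// addr_ge0 ?sqr_ge0.
have f1 n : (\int[nu]_t f n t <= 1)%E.
  have fi := levy_energy_integrable lnu (yw n).
  rewrite -[leLHS]fineK; last exact: integrable_fin_num fi.
  rewrite lee_fin -[fine _]/(kernel_energy nu levy_weight (w n)).
  have := A1 n; rewrite /energy.
  have : 0 <= a / sqn (w n) by rewrite divr_ge0// addr_ge0 ?sqr_ge0.
  lra.
(* the integrand converges to 1 off the origin, so Fatou's lemma bounds the
   mass of nu off the origin *)
have lim t : t \in [set: mR] -> limn_einf (f ^~ t) = (\1_(~` [set (0 : mR)]) t)%:E.
  move=> _; rewrite indic_setC1; apply: (cvg_limn_einf_sup _).1.
  apply/cvg_EFin; first by near=> n.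
  rewrite (_ : fine \o _ = fun n => levy_weight t / sqn (w n - t%:C))//.
  have [t0|t0] := eqVneq (t : R) 0.
    have E n : levy_weight t / sqn (w n - t%:C) = 0.
      by rewrite /levy_weight t0 expr2 !mul0r.
    by under eq_fun do rewrite E; exact: cvg_cst.
  have t2 : t ^+ 2 != 0 by rewrite sqrf_eq0.
  rewrite -(divff t2); apply: cvgM; first exact: cvg_cst.
  apply: cvgV => //.
  have -> : t ^+ 2 = (0 - t) ^+ 2 + 0 ^+ 2 by ring.
  have sub0 (g : C -> R) : (forall z, `|g z| <= normc z) ->
      (fun n => g (w n)) @ \oo --> (0 : R).
    move=> gz; apply: norm_cvg0; apply: cvg0_le W0 => n.
    by rewrite normr_ge0 gz.
  have -> : (fun n => sqn (w n - t%:C)) = (fun n =>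
    (complex.Re (w n) - t) * (complex.Re (w n) - t) +
    complex.Im (w n) * complex.Im (w n)).
    by apply/funext => n; rewrite /sqn !expr2; case: (w n) => x y /=; rewrite subr0.
  rewrite !expr2; apply: cvgD; apply: cvgM; try apply: cvgB; try exact: cvg_cst.
  - exact: sub0 (@normc_Re R).
  - exact: sub0 (@normc_Re R).
  - exact: sub0 (@normc_Im R).
  - exact: sub0 (@normc_Im R).
have m0 : measurable (~` [set (0 : mR)]).
  by apply: measurableC; exact: measurable_set1.
have : (nu (~` [set (0%R : mR)]) <= 1)%E.
  rewrite -[X in nu X]setIT -integral_indic//.
  rewrite -(eq_integral _ _ lim).
  apply: le_trans (fatou nu measurableT mf (fun n t _ => f0 n t)) _.
  rewrite limn_einf_lim; apply: lime_le; first exact: is_cvg_einfs.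
  near=> n; apply: le_trans (f1 n); apply: ereal_inf_lbound.
  by exists n => //=.
case: lnu => nu0 _ h.
have m1 : measurable [set (0 : mR)] by exact: measurable_set1.
rewrite -(setUv [set (0 : mR)]) (measureU _ m1 m0 (setICr _)).
rewrite [X in (X + _)%E](_ : _ = 0%E); last exact: nu0.
by rewrite add0e; apply: le_lt_trans h _; exact: ltry.
Unshelve. all: by end_near. Qed.

End finite_levy_measure.

(** * Atoms and free type A *)

Section atoms_of_FID.
Context {R : realType}.
Local Notation C := R[i].
Local Notation mR := (measurableTypeR R).
Variables (rho : probability mR R) (eta a : R).
Variable (nu : {measure set mR -> \bar R}).
Hypothesis triplet : free_characteristic_triplet rho eta a nu.
Local Notation H := (extended_right_inverse eta a nu).
Local Notation F := (reciprocal_cauchy_transform rho).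
Local Notation G := (cauchy_transform rho).
Local Notation V := (fine (nu setT)).

Lemma probability_set1_fin (x : R) : rho [set x] \is a fin_num.
Proof. exact: fin_num_measure. Qed.

(** Approach the atom [x0] vertically by [z] and let [w = F z]. Since [(z - x0)
    / w] tends to the mass [m > 0] of the atom, [w] tends to 0 nontangentially,
    while [H w = z] is in the upper half-plane: [nontangential_type_A] applies.
    Then [type_A_expansion] gives the limit of [H w], hence [x0], and the limit
    [1 - V] of [(H w - x0) / w], hence [m]. *)
Lemma atom_type_A (x0 : R) : rho [set x0] <> 0%E ->
  [/\ a = 0, (nu setT < +oo)%E, x0 = free_drift eta nu &
      fine (rho [set x0]) = 1 - V].
Proof.
move=> m0; pose m := fine (rho [set x0]).
have mpos : 0 < m.
  rewrite fine_gt0// lt0e measure_ge0 andbT; apply/andP; split; first exact/eqP.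
  by rewrite ltey_eq probability_set1_fin.
pose z n : C := x0 +i* harmonic n.
have zn : nontangential z x0 1 := nontangential_vertical x0.
pose u n := (z n - x0%:C) * G (z n).
have um : (fun n => normc (u n - m%:C)) @ \oo --> (0 : R).
  exact: (atom_limit (probability_ltey rho) zn).
(* From N on, |u| >= m / 2: this is what bounds the aperture of w by 2 / m. *)
have [N uN] : exists N, forall n, (N <= n)%N -> normc (u n - m%:C) < m / 2.
  have m20 : 0 < m / 2 by rewrite divr_gt0.
  have /cvgr_lt/(_ _ m20) [N _ h] := um.
  by exists N => n; exact: h.
pose z' n := z (n + N)%N; pose w n := F (z' n).
have yz n : 0 < complex.Im (z' n) by exact: harmonic_gt0.
have yw n : 0 < complex.Im (w n) by exact: Im_reciprocal_gt0.
have Hw n : H (w n) = z' n by apply: reciprocalK.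
have lnu := triplet_levy triplet; have a0 := triplet_ge0 triplet.
have Im_le n : complex.Im (z' n) <= complex.Im (w n).
  rewrite -Hw Im_right_inverse// ger_pMr// lerBlDr lerDl addr_ge0//.
    by rewrite divr_ge0// addr_ge0 ?sqr_ge0.
  by apply: kernel_energy_ge0 => t; exact: sqr_ge0.
have zE n : z' n - x0%:C = u (n + N)%N * w n.
  rewrite /u /w /reciprocal_cauchy_transform -mulrA divff ?mulr1//.
  exact: cauchy_neq0 (yz n).
have nz n : normc (z' n - x0%:C) = complex.Im (z' n).
  have [_ /(_ (n + N)%N)] := zn; rewrite mul1r => h _; apply/le_anti/andP; split => //.
  exact: Im_le_normcB.
have wz n : normc (w n) <= 2 / m * complex.Im (z' n).
  have u2 : m / 2 <= normc (u (n + N)%N).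
    have := uN _ (leq_addl n N).
    have := normc_triangle_rev m%:C (u (n + N)%N - m%:C).
    rewrite subrKC normc_real gtr0_norm//; lra.
  rewrite -nz zE normcM mulrA ler_peMl ?normc_ge0//.
  by rewrite -invf_div mulrC ler_pdivlMr ?divr_gt0// mul1r.
have wK n : normc (w n - 0%:C) <= 2 / m * complex.Im (w n).
  by rewrite subr0 (le_trans (wz n))// ler_pM2l ?divr_gt0.
have z'0 : (fun n => complex.Im (z' n)) @ \oo --> (0 : R).
  have := @cvg_harmonic R; rewrite -(cvg_shiftn N); exact.
have w0 : (fun n => normc (w n - 0%:C)) @ \oo --> (0 : R).
  apply: (@cvg0_le _ _ (fun n => 2 / m * complex.Im (z' n))).
    by move=> n; rewrite normc_ge0 subr0 wz.
  have h : (fun n => 2 / m * complex.Im (z' n)) @ \oo --> (2 / m * 0 : R).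
    by apply: cvgM => //; exact: cvg_cst.
  by rewrite mulr0 in h.
have wn : nontangential w 0 (2 / m) by split.
have [aE nufin] := nontangential_type_A triplet wn
  (fun n => eq_ind_r (fun v => 0 < complex.Im v) (yz n) (Hw n)).
have exp n : z' n = (free_drift eta nu)%:C +
    w n * ((1 - V)%:C + w n * cintegral nu (fun t => (w n - t%:C)^-1)).
  by rewrite -Hw aE type_A_expansion.
pose r n := w n * cintegral nu (fun t => (w n - t%:C)^-1).
have r0 : (fun n => normc (r n)) @ \oo --> (0 : R).
  have := atom_limit nufin wn; case: lnu => -> _.
  by under eq_fun do rewrite !subr0.
have V0 : 0 <= V := fine_mass_ge0 nu.
have xE : x0 = free_drift eta nu.
  apply/eqP; rewrite -subr_eq0 -normr_eq0 eq_le normr_ge0 andbT.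
  apply: (@ge0_le_cvg0 _ _
    (fun n => (1 + 2 / m * (1 + V + 2 / m * V)) * complex.Im (z' n))).
    move=> n; rewrite -normc_real.
    have -> : (x0 - free_drift eta nu)%:C =
      w n * ((1 - V)%:C + r n) - (z' n - x0%:C).
      by rewrite {1}exp rmorphB /= /r; ring.
    have b1 : normc ((1 - V)%:C + r n) <= 1 + V + 2 / m * V.
      rewrite (le_trans (normcD_le _ _))//; apply: lerD.
        by rewrite normc_real (le_trans (ler_normB _ _))// normr1 ger0_norm.
      rewrite (le_trans (moment_resolvent_le nufin (yw n)))// ler_wpM2r//.
      by rewrite ler_pdivrMr//; have := wK n; rewrite subr0.
    have b2 := ler_pM (normc_ge0 _) (normc_ge0 _) (wz n) b1.
    rewrite (le_trans (normcB_le _ _))// nz normcM; lra.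
  have h : (fun n => (1 + 2 / m * (1 + V + 2 / m * V)) * complex.Im (z' n)) @ \oo
      --> ((1 + 2 / m * (1 + V + 2 / m * V)) * 0 : R).
    by apply: cvgM => //; exact: cvg_cst.
  by rewrite mulr0 in h.
split=> //.
apply/eqP; rewrite -subr_eq0 -normr_eq0 eq_le normr_ge0 andbT -/m.
apply: (@ge0_le_cvg0 _ _ (fun n => normc (u (n + N)%N - m%:C) + normc (r n))).
  move=> n; rewrite -normc_real.
  have wn0 : w n != 0 by exact: Im_neq0.
  (* both sides are the slope (H w - x0) / w *)
  have uE : u (n + N)%N = (1 - V)%:C + r n.
    apply: (mulIf wn0); rewrite -zE exp xE /r; ring.
  have -> : (m - (1 - V))%:C = r n - (u (n + N)%N - m%:C).
    by rewrite uE rmorphB /=; ring.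
  by rewrite (le_trans (normcB_le _ _))// addrC.
rewrite -(addr0 (0 : R)); apply: cvgD => //.
by have := um; rewrite -(cvg_shiftn N); exact.
Qed.

(** Approach [free_drift] by [z = H w] with [w] tending to 0 vertically. If [V <
    1] this is a nontangential approach inside the upper half-plane, and [F z =
    w], so that [(z - free_drift) * G z] is the slope of [type_A_expansion]. *)
Lemma type_A_atom : a = 0 -> (nu setT < +oo)%E -> V < 1 ->
  fine (rho [set free_drift eta nu]) = 1 - V.
Proof.
move=> aE nufin V1; pose xt := free_drift eta nu.
have lnu := triplet_levy triplet; have V0 : 0 <= V := fine_mass_ge0 nu.
pose w n : C := 0 +i* harmonic n; pose z n := H (w n).
have yw n : 0 < complex.Im (w n) by exact: harmonic_gt0.
have wn : nontangential w 0 1 := nontangential_vertical 0.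
have nw n : normc (w n) = complex.Im (w n) by rewrite normc_imaginary// harmonic_gt0.
pose r n := w n * cintegral nu (fun t => (w n - t%:C)^-1).
have zE n : z n - xt%:C = w n * ((1 - V)%:C + r n).
  by rewrite /z aE type_A_expansion// addrAC subrr add0r.
have rV n : normc (r n) <= V.
  rewrite (le_trans (moment_resolvent_le nufin (yw n)))// nw divff ?mul1r//.
  by rewrite gt_eqF.
have r0 : (fun n => normc (r n)) @ \oo --> (0 : R).
  have := atom_limit nufin wn; case: lnu => -> _.
  by under eq_fun do rewrite !subr0.
have nz n : normc (z n - xt%:C) <= complex.Im (w n).
  rewrite zE normcM nw ler_piMr ?(ltW (yw n))// (le_trans (normcD_le _ _))//.
  by rewrite normc_real ger0_norm; have := rV n; lra.
(* the energy at w is at most the mass V: z stays in the upper half-plane and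
   approaches its limit nontangentially *)
have Imz n : complex.Im (w n) * (1 - V) <= complex.Im (z n).
  rewrite /z Im_right_inverse// ler_pM2l// lerD2l lerN2 /energy aE mul0r add0r.
  rewrite -[V]mul1r -(Rintegral_cst nu)//; apply: le_Rintegral => //.
  - exact: levy_energy_integrable.
  - exact: Rintegrable_cst.
  - move=> t _; rewrite ler_pdivrMr ?sqn_gt0 ?subr_real_neq0// mul1r.
    by rewrite /levy_weight /sqn /= sub0r sqrrN lerDl sqr_ge0.
have yz n : 0 < complex.Im (z n).
  by apply: lt_le_trans (Imz n); rewrite mulr_gt0// subr_gt0.
have zn : nontangential z xt (1 - V)^-1.
  split=> // [n|].
    by rewrite mulrC ler_pdivlMr ?subr_gt0// (le_trans _ (Imz n))// ler_pM2r ?subr_gt0.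
  apply: (@cvg0_le _ _ (fun n => complex.Im (w n))); last exact: cvg_harmonic.
  by move=> n; rewrite normc_ge0 nz.
apply/eqP; rewrite -subr_eq0 -normr_eq0 eq_le normr_ge0 andbT.
have ml := atom_limit (probability_ltey rho) zn.
set m := fine (rho _).
apply: (@ge0_le_cvg0 _ _ (fun n => normc (r n) +
   normc ((z n - xt%:C) * G (z n) - m%:C))).
  move=> n; rewrite -normc_real.
  have wn0 : w n != 0 by exact: Im_neq0.
  have GE : G (z n) = (w n)^-1.
    by rewrite -[in RHS](right_inverseK triplet (yw n) (yz n)) invrK.
  have -> : (m - (1 - V))%:C = r n - ((z n - xt%:C) * G (z n) - m%:C).
    by rewrite zE GE mulrAC divff// mul1r rmorphB /=; ring.
  exact: normcB_le.
by rewrite -(addr0 (0 : R)); exact: cvgD.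
Qed.

End atoms_of_FID.

(** * Scaling the Levy measure *)

Section scaling.
Context {R : realType}.
Local Notation mR := (measurableTypeR R).

Lemma Rintegral_mscale (nu : {measure set mR -> \bar R}) (s : {nonneg R})
    (f : mR -> R) : nu.-integrable setT (EFin \o f) ->
  Rintegral (mscale s nu) setT f = s%:num * Rintegral nu setT f.
Proof.
move=> fi; have /integrableP[mf _] := fi.
rewrite /Rintegral integralE !ge0_integral_mscale//; first last.
- exact: measurable_funepos.
- exact: measurable_funeneg.
have fp : (\int[nu]_x (EFin \o f)^\+ x)%E \is a fin_num.
  exact: integrable_pos_fin_num.
have fn : (\int[nu]_x (EFin \o f)^\- x)%E \is a fin_num.
  exact: integrable_neg_fin_num.
rewrite -muleBr ?fin_num_adde_defr ?fin_numN//.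
by rewrite -integralE fineM//; exact: integrable_fin_num.
Qed.

Lemma free_drift_mscale (eta : R) (nu : {measure set mR -> \bar R})
    (s : {nonneg R}) : (nu setT < +oo)%E ->
  free_drift (s%:num * eta) (mscale s nu) = s%:num * free_drift eta nu.
Proof.
move=> nufin; rewrite /free_drift Rintegral_mscale ?mulrBr//.
apply: (@Rintegrable_dom _ _ _ (fun=> 1)); last exact: Rintegrable_cst.
  apply: measurable_funM; first exact: measurable_id.
  by apply: measurable_indic; exact: measurable_itv.
move=> t; rewrite indic_unit_itv normrM.
by case: (leP `|t| 1) => t1; rewrite ?normr1 ?normr0 ?mulr1 ?mulr0.
Qed.

End scaling.

(** * Atoms of the free convolution powers *)

Theorem theorem3p3 (R : realType)
    (mu : probability (measurableTypeR R) R)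
    (eta a : R) (nu : {measure set (measurableTypeR R) -> \bar R})
    (Hmu : FID_with_triplet mu eta a nu)
    (mupow : {nonneg R} -> probability (measurableTypeR R) R)
    (Hmupow : forall s : {nonneg R},
      FID_with_triplet (mupow s) (s%:num * eta) (s%:num * a) (mscale s nu)) :
  ((exists s : {nonneg R}, 0 < s%:num /\ ~ continuous_measure (mupow s)) <->
   free_type_A a nu) /\
  (free_type_A a nu ->
   (exists x0 : R,
     ((fun y : R => extended_right_inverse eta a nu (0 +i* y) : R[i]^o)
        @ 0^'+ --> (x0%:C : R[i]^o)) /\
     (forall s : {nonneg R}, (s%:num%:E < (nu setT)^-1)%E ->
        mupow s [set s%:num * x0] = (1 - s%:num%:E * nu setT)%E)) /\
   (forall s : {nonneg R}, ((nu setT)^-1 <= s%:num%:E)%E ->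
      continuous_measure (mupow s))).
Proof.
have tr s := (Hmupow s).2.
have lnu : levy_measure nu by case: Hmu => _ [].
have V0 : 0 <= fine (nu setT) := fine_mass_ge0 nu.
have finE : (nu setT < +oo)%E -> nu setT = (fine (nu setT))%:E.
  by move=> h; rewrite fineK// ge0_fin_numE// measure_ge0.
have scaleE (s : {nonneg R}) : (nu setT < +oo)%E ->
    (mscale s nu) setT = (s%:num * fine (nu setT))%:E.
  by move=> h; rewrite /mscale /= finE.
have atomE (s : {nonneg R}) : free_type_A a nu ->
    s%:num * fine (nu setT) < 1 ->
    mupow s [set s%:num * free_drift eta nu] = (1 - s%:num%:E * nu setT)%E.
  move=> [aE nufin] s1.
  have sE := scaleE s nufin.
  have sfin : (mscale s nu setT < +oo)%E by rewrite sE ltry.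
  have sV : fine (mscale s nu setT) = s%:num * fine (nu setT) by rewrite sE.
  have := type_A_atom (tr s); rewrite aE mulr0 => /(_ erefl sfin).
  move=> /(_ (eq_ind_r (fun v => v < 1) s1 sV)).
  rewrite free_drift_mscale// => E.
  rewrite -[LHS]fineK; last exact: probability_set1_fin.
  by rewrite E sV [in RHS]finE.
have no_atom (s : {nonneg R}) : free_type_A a nu ->
    1 <= s%:num * fine (nu setT) -> continuous_measure (mupow s).
  move=> [aE nufin] s1 x; apply: contrapT => nx.
  have [_ _ _ E] := atom_type_A (tr s) nx.
  have {}E : fine (mupow s [set x]) = 1 - s%:num * fine (nu setT).
    have sV : fine (mscale s nu setT) = s%:num * fine (nu setT).
      by rewrite scaleE.
    exact: (eq_trans E (congr1 (fun v => 1 - v) sV)).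
  have p0 : 0 <= fine (mupow s [set x]) by rewrite fine_ge0// measure_ge0.
  apply: nx; rewrite -[LHS]fineK; last exact: probability_set1_fin.
  congr (_%:E); lra.
split; [split|].
- move=> [s [s0 nc]].
  have [x nx] : exists x, mupow s [set x] <> 0%E by exact/existsNP.
  have [sa sfin _ _] := atom_type_A (tr s) nx; split.
    by move/eqP: sa; rewrite mulf_eq0 (gt_eqF s0) => /eqP.
  rewrite ltNge leye_eq; apply/negP => /eqP nuy.
  have sy : mscale s nu setT = +oo%E.
    by rewrite -[LHS]/((s%:num%:E * nu setT)%E) nuy gt0_muley ?lte_fin.
  by have := sfin; rewrite [X in (X < _)%E]sy ltxx.
- move=> tA; have k0 : 0 < fine (nu setT) + 1 by rewrite ltr_wpDl.
  have s0 : 0 <= (fine (nu setT) + 1)^-1 by rewrite invr_ge0 ltW.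
  pose s := NngNum s0.
  have s1 : s%:num * fine (nu setT) < 1.
    by rewrite /= mulrC ltr_pdivrMr// mul1r ltrDl.
  exists s; split; first by rewrite /= invr_gt0.
  move=> /(_ (s%:num * free_drift eta nu)) h.
  have := eq_trans (esym h) (atomE s tA s1); rewrite (finE tA.2).
  by move=> /eqP; rewrite -EFinM -EFinB eqe => /eqP; lra.
move=> tA; have nufin := tA.2.
have [v0|vpos] := eqVneq (fine (nu setT)) 0.
  split.
    exists (free_drift eta nu); split; last first.
      by move=> s _; apply: atomE => //; rewrite v0 mulr0.
    by rewrite tA.1; exact: right_inverse_drift_cvg.
  by move=> s; rewrite finE// v0 inve0.
have {}vpos : 0 < fine (nu setT) by rewrite lt0r vpos.
split.
  exists (free_drift eta nu); split.
    by rewrite tA.1; exact: right_inverse_drift_cvg.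
  move=> s; rewrite {1}finE// inver (gt_eqF vpos) lte_fin => sv.
  by apply: atomE => //; rewrite -ltr_pdivlMr// div1r.
move=> s; rewrite finE// inver (gt_eqF vpos) lee_fin => sv.
by apply: no_atom => //; rewrite -ler_pdivrMr// div1r.
Qed.
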